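(* Let $\gamma\geq 0$, $\lambda>0$, and put $\theta_i=2\beta_i/\lambda^2$, $i=1,2,3$, where $\beta_1,\beta_2,\beta_3$ are real parameters such that one of the following conditions holds: $$\theta_1\geq1,\ \theta_2>0,\ \theta_3\geq0;\qquad 1-2\gamma\leq\theta_1<1,\ \theta_2>0,\ \theta_3>0;\qquad \theta_1<1-2\gamma,\ \theta_2\geq0,\ \theta_3>0.$$ Consider the generalized inverse Gaussian diffusion, i.e. the ergodic solution of $$dX_t=\left(\beta_1X_t^{2\gamma-1}-\beta_2X_t^{2\gamma}+\beta_3X_t^{2(\gamma-1)}\right)dt+\lambda X_t^\gamma\,dW_t,\qquad X_0=x_0>0,$$ whose invariant density is the generalized inverse Gaussian density $$f(x)=\frac12\left(\frac{\theta_2}{\theta_3}\right)^{\frac{\theta_1-2\gamma+1}{2}}\frac{x^{\theta_1-2\gamma}\exp\left\{-\theta_2x-\theta_3x^{-1}\right\}}{K_{\theta_1-2\gamma+1}\left(2\sqrt{\theta_2\theta_3}\right)},\qquad x>0.$$ Then the Rényi information of $f$ (of order $\alpha>0$, $\alpha\neq1$) is $$\mathcal{R}_\alpha(f)=-\log\left(\frac12\sqrt{\frac{\theta_2}{\theta_3}}\right)+\frac{1}{1-\alpha}\log\frac{K_{\alpha(\theta_1-2\gamma)+1}\left(2\alpha\sqrt{\theta_2\theta_3}\right)}{K_{\theta_1-2\gamma+1}^{\alpha}\left(2\sqrt{\theta_2\theta_3}\right)},$$ and the Shannon entropy of $f$ is $$\begin{aligned}\mathcal R_1(f)=&-\log\left(\frac12\sqrt{\frac{\theta_2}{\theta_3}}\right)+(\theta_1-2\gamma+1)+\log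 K_{\theta_1-2\gamma+1}\left(2\sqrt{\theta_2\theta_3}\right)\\&-(\theta_1-2\gamma)\frac{\dot K_{\theta_1-2\gamma+1}\left(2\sqrt{\theta_2\theta_3}\right)}{K_{\theta_1-2\gamma+1}\left(2\sqrt{\theta_2\theta_3}\right)}+2\sqrt{\theta_2\theta_3}\,\frac{K_{\theta_1-2\gamma}\left(2\sqrt{\theta_2\theta_3}\right)}{K_{\theta_1-2\gamma+1}\left(2\sqrt{\theta_2\theta_3}\right)},\end{aligned}$$ where $\dot K_\nu=\frac{\partial}{\partial\nu}K_\nu$.
   Context: For a probability density $f$ and $\alpha>0$, $\alpha\neq1$, the Rényi information of order $\alpha$ is $\mathcal R_\alpha(f)=\frac{1}{1-\alpha}\log\int f^\alpha(x)\,dx$, and the Shannon entropy is $\mathcal R_1(f)=\lim_{\alpha\to1}\mathcal R_\alpha(f)=-\int f(x)\log f(x)\,dx$. $W_t$ is a standard Wiener process. For $\nu\in\mathbb{R}$, $K_\nu$ is the modified Bessel function of the third kind (also called second kind) with index $\nu$: $$K_\nu(x)=\frac12\int_0^\infty\exp\left\{-\frac x2(u+u^{-1})\right\}u^{-\nu-1}\,du.$$ The notation $\dot K_\nu(x)$ means the partial derivative of $K_\nu(x)$ with respect to the index $\nu$ at fixed argument $x$; $K_\nu^\alpha(x)$ means $(K_\nu(x))^\alpha$.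
   Formalization: When θ2=0 or θ3=0 the printed formulas are undefined (θ2/θ3, K at 0); there they are read as limits as that parameter decreases to 0, for ergodic cases. The diffusion enters through its coefficients; its invariant density is the normalized speed density. *)

(* Defs.v *)
From HB Require Import structures.
From mathcomp Require Import all_boot all_order all_algebra.
From mathcomp Require Import all_classical all_reals all_analysis.

Set Implicit Arguments.
Unset Strict Implicit.
Unset Printing Implicit Defensive.

Import Order.TTheory GRing.Theory Num.Theory.
Import numFieldNormedType.Exports.

Local Open Scope classical_set_scope.
Local Open Scope ring_scope.

(* Densities live on ]0, +oo[.  Extended-real valued: the integral of f^alpha may be infinite. *)
Definition renyi (R : realType) (a : R) (f : R -> R) : \bar R :=
  (((1 - a)^-1)%:E *
   lne (\int[lebesgue_measure]_(x in `]0%R, +oo[) ((f x) `^ a)%:E))%E.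

(* The library's [+oo - +oo] is [-oo], so an equation stating that this value
   is finite entails that f log f is integrable. *)
Definition shannon (R : realType) (f : R -> R) : \bar R :=
  (- \int[lebesgue_measure]_(x in `]0%R, +oo[) (f x * ln (f x))%:E)%E.

Definition oriented_integral (R : realType) (g : R -> R) (a b : R) : R :=
  if a <= b then \int[lebesgue_measure]_(x in `[a, b]) g x
  else - \int[lebesgue_measure]_(x in `[b, a]) g x.

(* Here and below b and s are the coefficients of dX = b(X) dt + s(X) dW on
   ]0, +oo[, with X_0 = x0. *)
Definition scale_density (R : realType) (b s : R -> R) (x0 x : R) : R :=
  expR (- oriented_integral (fun y => 2 * b y / s y ^+ 2) x0 x).

Definition speed_density (R : realType) (b s : R -> R) (x0 x : R) : R :=
  (s x ^+ 2 * scale_density b s x0 x)^-1.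

(* Recurrence (the scale function is unbounded at both ends of the state
   space) together with finiteness of the speed measure. *)
Definition ergodic (R : realType) (b s : R -> R) (x0 : R) : Prop :=
  [/\ (\int[lebesgue_measure]_(x in `]0%R, x0])
         (scale_density b s x0 x)%:E = +oo)%E,
      (\int[lebesgue_measure]_(x in `[x0, +oo[)
         (scale_density b s x0 x)%:E = +oo)%E &
      (\int[lebesgue_measure]_(x in `]0%R, +oo[)
         (speed_density b s x0 x)%:E < +oo)%E].

(* The invariant law of an ergodic scalar diffusion is its normalized speed
   measure; the result does not depend on the base point x0. *)
Definition invariant_density (R : realType) (b s : R -> R) (x0 x : R) : R :=
  speed_density b s x0 x /
  \int[lebesgue_measure]_(y in `]0, +oo[) speed_density b s x0 y.

Definition gig_drift (R : realType) (g b1 b2 b3 x : R) : R :=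
  b1 * x `^ (2 * g - 1) - b2 * x `^ (2 * g) + b3 * x `^ (2 * (g - 1)).

Definition gig_diffusion (R : realType) (g l x : R) : R := l * x `^ g.

Definition besselK (R : realType) (nu x : R) : R :=
  2^-1 * \int[lebesgue_measure]_(u in `]0, +oo[)
           (expR (- (x / 2) * (u + u^-1)) * u `^ (- nu - 1)).

Definition besselK_dot (R : realType) (nu x : R) : R :=
  derive1 (fun v : R => besselK v x) nu.

Definition gig_density (R : realType) (g t1 t2 t3 x : R) : R :=
  2^-1 * (t2 / t3) `^ ((t1 - 2 * g + 1) / 2) *
  (x `^ (t1 - 2 * g) * expR (- t2 * x - t3 * x^-1)) /
  besselK (t1 - 2 * g + 1) (2 * Num.sqrt (t2 * t3)).

Definition gig_renyi (R : realType) (g t1 a t2 t3 : R) : R :=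
  - ln (2^-1 * Num.sqrt (t2 / t3)) +
  (1 - a)^-1 *
    ln (besselK (a * (t1 - 2 * g) + 1) (2 * a * Num.sqrt (t2 * t3)) /
        (besselK (t1 - 2 * g + 1) (2 * Num.sqrt (t2 * t3))) `^ a).

Definition gig_shannon (R : realType) (g t1 t2 t3 : R) : R :=
  let z := 2 * Num.sqrt (t2 * t3) in
  let p := t1 - 2 * g + 1 in
  - ln (2^-1 * Num.sqrt (t2 / t3)) + p + ln (besselK p z)
  - (t1 - 2 * g) * (besselK_dot p z / besselK p z)
  + z * (besselK (t1 - 2 * g) z / besselK p z).

(* [l] is the value at (t2, t3) of the expression F.  The expressions above
   involve t2 / t3 and Bessel functions at a multiple of sqrt (t2 * t3), so
   they make sense as written only for t2, t3 > 0; when one of the two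
   parameters vanishes they are read, as is usual for the generalized inverse
   Gaussian law (gamma and inverse gamma cases), as limits when that parameter
   decreases to 0. *)
Definition has_value (R : realType) (T : topologicalType) (F : R -> R -> T)
    (t2 t3 : R) (l : T) : Prop :=
  [/\ 0 < t2 -> 0 < t3 -> l = F t2 t3,
      t3 = 0 -> F t2 e @[e --> 0^'+] --> l &
      t2 = 0 -> F e t3 @[e --> 0^'+] --> l].

(* Main.v *)
Require Import Defs.
From HB Require Import structures.
From mathcomp Require Import all_boot all_order all_algebra.
From mathcomp Require Import all_classical all_reals all_analysis.
From mathcomp Require Import measurable_realfun.
From mathcomp Require Import ring lra.

(* Write k q a b x = x^q exp(- a x - b / x) on ]0, +oo[ and Z q a b for its
   integral.  The speed density of the diffusion is a multiple of k with
   (q, a, b) = (theta1 - 2 gamma, theta2, theta3), so the invariant density is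
   f = k / Z; the substitution x = sqrt (b / a) / u turns Z into a Bessel
   function.  Powers of k are again of the form k, whence the Renyi information
   through Z (alpha q) (alpha a) (alpha b).  The entropy is the derivative of
   the latter at alpha = 1; it involves the integral of k ln, which is dZ / dq,
   and is put in the stated form by the recurrence
   a Z (q + 1) = (q + 1) Z q + b Z (q - 1), an integration by parts.
   When a or b vanishes, finiteness of Z is an open condition on the ray
   t (q, a, b) near t = 1, which gives the domination needed for the limits:
   k |ln k| is bounded by k^(1 + delta) + k^(1 - delta), and both terms increase
   when a and b decrease. *)

Import Order.TTheory GRing.Theory Num.Theory.
Import numFieldNormedType.Exports.

Local Open Scope classical_set_scope.
Local Open Scope ring_scope.

(** * The kernel, exhaustion of the half-line by compact intervals, inversion *)

Section gig_kernel.
Context {R : realType}.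
Implicit Types (q a b c x : R).
Notation mu := (@lebesgue_measure R).
Notation D := (`]0%R, +oo[%classic : set R).

(** The closed formulas live at [a, b > 0], where [Z] is finite for every [q]; this freedom in [q]
    permits the differentiation in the index and the recurrence. On the boundary it is lost: the ray
    [t (q, a, b)] may leave the domain of finiteness, so the integral of [f^alpha] may be infinite.
    Hence masses are extended reals, and their limits come from monotonicity in [a] and [b], which
    covers infinite values; the entropy integrand changes sign and is handled by domination. The
    derivative in the index [q] and the derivative in [t] along the ray are two instances of one
    statement on families [expR (A x + s * L x)]: [L = ln] with [A] the exponent at index 0, and [L]
    the whole exponent with [A = 0]. Integrability at the two values [s0 + delta] and [s0 - delta]
    dominates all values in between. *)

Definition gig_exponent q a b x : R := q * ln x - a * x - b * x^-1.

Definition gig_kernel q a b x : R := expR (gig_exponent q a b x).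

Definition gig_mass q a b : \bar R :=
  (\int[mu]_(x in D) (gig_kernel q a b x)%:E)%E.

(** The slope can be arbitrarily small: apply [ln y < y] at [y = e * x]; the constant absorbs
    [- ln e]. *)
Lemma ln_le_linear (e : R) : 0 < e ->
  exists2 C : R, 0 <= C & forall x, 0 < x -> ln x <= e * x + C.
Proof.
move=> e0; exists `|ln e| => // x x0.
have : ln (e * x) < e * x by apply: ln_sublinear; exact: mulr_gt0.
rewrite lnM ?posrE// => h.
have := ler_norm (- ln e); rewrite normrN; lra.
Qed.

Lemma norm_ln_le (e : R) : 0 < e ->
  exists2 C : R, 0 <= C & forall x, 0 < x -> `|ln x| <= e * x + e * x^-1 + C.
Proof.
move=> e0; have [C C0 H] := ln_le_linear _ e0; exists C => // x x0.
have x'0 : 0 < x^-1 by rewrite invr_gt0.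
have h1 := H _ x0; have := H _ x'0; rewrite lnV ?posrE// => h2.
have p1 : 0 < e * x by exact: mulr_gt0.
have p2 : 0 < e * x^-1 by exact: mulr_gt0.
by rewrite ler_norml; apply/andP; split; lra.
Qed.

Lemma is_derive_inv (x : R) : 0 < x -> is_derive x 1 (fun y : R => y^-1) (- x ^- 2).
Proof.
move=> x0; have h : is_derive x 1 (@idfun R) 1 by exact: is_derive_id.
apply: is_derive_eq; first by apply: (@is_deriveV R idfun) h; rewrite gt_eqF.
by rewrite /GRing.scale/= mulr1.
Qed.

Lemma is_derive_gig_exponent q a b (x : R) : 0 < x ->
  is_derive x 1 (gig_exponent q a b) (q / x - a + b / x ^+ 2).
Proof.
move=> x0; have h1 := @is_deriveZ _ _ _ _ q _ _ _ (@is_derive1_ln R _ x0).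
have h2 := @is_deriveZ _ _ _ _ a _ _ _ (is_derive_id x (1 : R)).
have h3 := @is_deriveZ _ _ _ _ b _ _ _ (@is_derive_inv _ x0).
have h4 := is_deriveB (is_deriveB h1 h2) h3.
apply: (is_derive_eq (h4 : is_derive x 1 (gig_exponent q a b) _)).
by rewrite /GRing.scale/= mulr1 mulrN opprK.
Qed.

Lemma is_derive_gig_kernel q a b (x : R) : 0 < x ->
  is_derive x 1 (gig_kernel q a b)
    (gig_kernel q a b x * (q / x - a + b / x ^+ 2)).
Proof.
move=> x0; have h := is_derive_gig_exponent q a b _ x0.
exact: (is_derive1_comp _ h).
Qed.

Lemma continuous_gig_exponent q a b x : 0 < x ->
  {for x, continuous (gig_exponent q a b)}.
Proof.
move=> x0; apply: cvgB; first apply: cvgB.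
- by apply: cvgMr; exact: continuous_ln.
- by apply: cvgMr; exact: cvg_id.
- by apply: cvgMr; apply: cvgV; [rewrite gt_eqF|exact: cvg_id].
Qed.

Lemma continuous_gig_kernel q a b x : 0 < x ->
  {for x, continuous (gig_kernel q a b)}.
Proof.
move=> x0; apply: continuous_comp; first exact: continuous_gig_exponent.
exact: continuous_expR.
Qed.

Lemma continuous_measurable_pos (f : R -> R) :
  (forall x, 0 < x -> {for x, continuous f}) -> measurable_fun D f.
Proof.
move=> cf; apply: open_continuous_measurable_fun; first exact: interval_open.
by move=> x; rewrite inE/= in_itv/= andbT; exact: cf.
Qed.

Lemma measurable_gig_exponent q a b : measurable_fun D (gig_exponent q a b).
Proof. by apply: continuous_measurable_pos => x; exact: continuous_gig_exponent. Qed.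

Lemma measurable_gig_kernel q a b : measurable_fun D (gig_kernel q a b).
Proof. by apply: continuous_measurable_pos => x; exact: continuous_gig_kernel. Qed.

Lemma gig_kernel_gt0 q a b x : 0 < gig_kernel q a b x.
Proof. exact: expR_gt0. Qed.

(** Compact intervals on which the fundamental theorem of calculus and substitution apply. The map
    [u |-> c / u] sends [exhaust 1 n] onto [exhaust c n], hence the parameter [c]. *)
Definition exhaust c (n : nat) : set R := `[c / n.+1%:R, c * n.+1%:R]%classic.

Lemma bigcup_exhaust c : 0 < c -> \bigcup_n exhaust c n = D.
Proof.
move=> c0; apply/seteqP; split => x /=.
  move=> [n _]; rewrite /exhaust/= !in_itv/= andbT => /andP[h _].
  by apply: lt_le_trans h; rewrite divr_gt0.
rewrite in_itv/= andbT => x0.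
(* Any [n.+1] above both ratios puts [x] in the interval. *)
exists (Num.truncn (c / x + x / c)) => //=; rewrite /exhaust/= in_itv/=.
have := truncnS_gt (c / x + x / c); set N := _.+1 => h.
have N0 : 0 < N%:R :> R by rewrite ltr0n.
have p1 : 0 < c / x by exact: divr_gt0.
have p2 : 0 < x / c by exact: divr_gt0.
rewrite ler_pdivrMr// -ler_pdivrMl// mulrC -ler_pdivrMl// mulrC.
by apply/andP; split; apply: ltW; lra.
Qed.

Lemma integral_exhaust c (f : R -> \bar R) : 0 < c ->
  measurable_fun D f -> (forall x, 0 < x -> (0 <= f x)%E) ->
  (\int[mu]_(x in exhaust c n) f x @[n --> \oo] --> \int[mu]_(x in D) f x)%E.
Proof.
move=> c0 mf f0; rewrite -(bigcup_exhaust _ c0).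
have sD n : exhaust c n `<=` D.
  by rewrite -(bigcup_exhaust _ c0); exact: bigcup_sup.
apply: ge0_nondecreasing_set_cvg_integral => //.
- move=> m n mn; rewrite subsetEset; apply: subset_itv; rewrite bnd_simp.
    by rewrite ler_pM2l// lef_pV2 ?posrE ?ltr0n// ler_nat.
  by rewrite ler_pM2l// ler_nat.
- by move=> n; exact: measurable_itv.
- by move=> n; apply: measurable_funS mf => //; exact: measurable_itv.
- by move=> n x /sD /=; rewrite in_itv/= andbT; exact: f0.
Qed.

Lemma integral_exhaust_le c (f : R -> \bar R) (M : \bar R) : 0 < c ->
  measurable_fun D f -> (forall x, 0 < x -> (0 <= f x)%E) ->
  (forall n, \int[mu]_(x in exhaust c n) f x <= M)%E ->
  (\int[mu]_(x in D) f x <= M)%E.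
Proof.
move=> c0 mf f0 fM; have h := integral_exhaust _ _ c0 mf f0.
rewrite -(cvg_lim _ h)//; apply: lime_le; first by apply/cvg_ex; eexists; exact: h.
exact: nearW.
Qed.

(* Substitution [x = c / u] *)
Lemma gig_mass_inversion q a b c : 0 < c ->
  gig_mass q a b = ((expR ((q + 1) * ln c))%:E * gig_mass (- q - 2) (b / c) (a * c))%E.
Proof.
move=> c0; rewrite /gig_mass -ge0_integralZl//; last 2 first.
- by apply/measurable_EFinP; exact: measurable_gig_kernel.
- by move=> x _; rewrite lee_fin ltW// gig_kernel_gt0.
have mL : measurable_fun D (EFin \o gig_kernel q a b).
  by apply/measurable_EFinP; exact: measurable_gig_kernel.
have h1 := integral_exhaust _ _ c0 mL.
have h2 := integral_exhaust 1 (fun x => (expR ((q + 1) * ln c))%:E *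
   (gig_kernel (- q - 2) (b / c) (a * c) x)%:E)%E ltr01.
(* Both sides are limits along exhaustions, over [exhaust c n] on the left and [exhaust 1 n] on the
   right; the substitution matches them for each [n]. *)
apply: cvg_unique (h1 _) _ => //; first by move=> x _; rewrite lee_fin ltW// gig_kernel_gt0.
apply: cvg_trans (h2 _ _); last 2 first.
- by apply/measurable_EFinP; apply: measurable_funM => //; exact: measurable_gig_kernel.
- by move=> x _; rewrite lee_fin mulr_ge0// expR_ge0.
apply: near_eq_cvg; apply: nearW => n; apply/esym.
rewrite /exhaust.
have n0 : 0 < n.+1%:R :> R by rewrite ltr0n.
have n1 : (1 : R) / n.+1%:R <= 1 * n.+1%:R.
  rewrite !mul1r (@le_trans _ _ 1)// ?invf_le1// ?ler1n//.
have nD (x : R) : x \in `[1 / n.+1%:R, 1 * n.+1%:R] -> 0 < x.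
  by rewrite in_itv/= => /andP[+ _]; apply: lt_le_trans; rewrite divr_gt0.
pose F u : R := c / u.
have dF (u : R) : 0 < u -> is_derive u 1 F (- c / u ^+ 2).
  move=> u0; have u1 : u != 0 by rewrite gt_eqF.
  have h := @is_deriveZ _ _ _ _ c _ _ _ (is_derive_inv _ u0).
  by apply: (is_derive_eq h); rewrite /GRing.scale/= mulrN mulNr.
have F' (u : R) : 0 < u -> derive1 F u = - c / u ^+ 2.
  by move=> u0; rewrite derive1E; apply: derive_val; exact: dF.
have cdF (u : R) : 0 < u -> {for u, continuous F}.
  by move=> u0; apply: differentiable_continuous; apply/derivable1_diffP; have [] := dF _ u0.
have cF' (u : R) : 0 < u -> derive1 F x @[x --> u] --> - c / u ^+ 2.
  move=> u0; have u1 : u != 0 by rewrite gt_eqF.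
  have : (- c / x ^+ 2) @[x --> u] --> - c / u ^+ 2.
    apply: cvgMr; apply: cvgV; first by rewrite expf_neq0.
    by apply: cvgM; exact: cvg_id.
  apply: cvg_trans; apply: near_eq_cvg; near=> x; apply/esym/F'.
  by near: x; exact: (@lt_nbhsr R 0 u u0).
have := @integration_by_substitution_decreasing R F (gig_kernel q a b) _ _ n1.
have -> : F (1 * n.+1%:R) = c / n.+1%:R by rewrite /F mul1r.
have -> : F (1 / n.+1%:R) = c * n.+1%:R by rewrite /F mul1r invrK.
move=> ->.
- apply: eq_integral => x; rewrite inE/= => /nD x0; rewrite -EFinM; congr EFin.
  rewrite [LHS](_ : _ = gig_kernel q a b (F x) * - derive1 F x)// F'// /gig_kernel /gig_exponent mulNr opprK.
  (* The Jacobian enters the exponential, so that only two exponents remain to be compared. *)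
  have -> : c / x ^+ 2 = expR (ln c - 2 * ln x).
    by rewrite expRB (expRM_natl 2) !lnK ?posrE.
  rewrite -!expRD /F lnM ?posrE ?invr_gt0// lnV ?posrE//; congr expR.
  have [xn cn] : x != 0 /\ c != 0 by rewrite !gt_eqF.
  by field; rewrite xn cn.
- move=> x y /nD x0 /nD y0 xy; rewrite /F ltr_pM2l// ltf_pV2 ?posrE//.
- move=> x xI; rewrite /continuous_at F'; last by apply: nD; exact: subset_itv_oo_cc.
  by apply: cF'; apply: nD; exact: subset_itv_oo_cc.
- apply/cvg_ex; exists (- c / (1 / n.+1%:R) ^+ 2); apply: cvg_at_right_filter.
  by apply: cF'; rewrite divr_gt0.
- apply/cvg_ex; exists (- c / (1 * n.+1%:R) ^+ 2); apply: cvg_at_left_filter.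
  by apply: cF'; rewrite mul1r.
- split.
  + by move=> x xI; have [] := dF x (nD _ (subset_itv_oo_cc xI)).
  + by apply: cvg_at_right_filter; apply: cdF; rewrite divr_gt0.
  + by apply: cvg_at_left_filter; apply: cdF; rewrite mul1r.
- apply: continuous_in_subspaceT => x; rewrite inE/= in_itv/= => /andP[cx _].
  by apply: continuous_gig_kernel; apply: lt_le_trans cx; exact: divr_gt0.
Unshelve. all: by end_near. Qed.

End gig_kernel.

(** * Divergence and convergence of the mass when [b = 0] *)

Section gig_mass.
Context {R : realType}.
Implicit Types (q a b c x : R).
Notation mu := (@lebesgue_measure R).
Notation D := (`]0%R, +oo[%classic : set R).

Lemma continuous_FTC2_pos (F f : R -> R) a b : 0 < a -> a <= b ->
  (forall x, 0 < x -> is_derive x 1 F (f x)) ->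
  (forall x, 0 < x -> {for x, continuous f}) ->
  (\int[mu]_(x in `[a, b]) (f x)%:E = (F b - F a)%:E)%E.
Proof.
move=> a0; rewrite le_eqVlt => /predU1P[<-|ab] dF cf.
  by rewrite subrr set_itv1 integral_set1.
have pos x : a <= x -> 0 < x by exact: lt_le_trans.
have cF x : 0 < x -> {for x, continuous F}.
  move=> x0; apply: differentiable_continuous.
  by apply/derivable1_diffP; have [] := dF _ x0.
rewrite (@continuous_FTC2 _ f F)//.
- apply: continuous_in_subspaceT => x; rewrite inE/= in_itv/= => /andP[/pos + _].
  exact: cf.
- split.
  + by move=> x; rewrite in_itv/= => /andP[/ltW/pos/dF[]].
  + by apply: cvg_at_right_filter; exact: cF.
  + by apply: cvg_at_left_filter; apply: cF; apply: pos; exact: ltW.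
- move=> x; rewrite in_itv/= => /andP[/ltW/pos x0 _].
  by rewrite derive1E; apply: derive_val; exact: dF.
Qed.

Lemma integral_inv_segment c a b : 0 < a -> a <= b ->
  (\int[mu]_(x in `[a, b]) (c * x^-1)%:E = (c * (ln b - ln a))%:E)%E.
Proof.
move=> a0 ab; have dF (x : R) : 0 < x -> is_derive x 1 (fun y => c * ln y) (c * x^-1).
  by move=> x0; exact: (@is_deriveZ _ _ _ _ c _ _ _ (@is_derive1_ln R _ x0)).
rewrite (continuous_FTC2_pos _ _ _ _ a0 ab dF) ?mulrBr// => x x0.
by apply: cvgMr; apply: cvgV; [rewrite gt_eqF|exact: cvg_id].
Qed.

Lemma measurable_inv_pos c : measurable_fun D (fun x => (c * x^-1)%:E).
Proof.
apply/measurable_EFinP; apply: continuous_measurable_pos => x x0.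
by apply: cvgMr; apply: cvgV; [rewrite gt_eqF|exact: cvg_id].
Qed.

Lemma integral_pinfty (A : set R) (f : R -> \bar R) :
  (forall M : R, 0 < M -> (M%:E <= \int[mu]_(x in A) f x)%E) ->
  (\int[mu]_(x in A) f x = +oo)%E.
Proof.
move=> h; apply/eqyP => M M0; exact: h.
Qed.

Lemma integral_ge_inv0 (f : R -> R) c (r : R) : 0 < c -> 0 < r ->
  measurable_fun D f ->
  (forall x, 0 < x -> x <= r -> c * x^-1 <= f x) ->
  (\int[mu]_(x in `]0%R, r]) (f x)%:E = +oo)%E.
Proof.
move=> c0 r0 mf cf; apply: integral_pinfty => M M0.
(* Solves [c * (ln r - ln a) = M]. *)
pose a : R := r * expR (- (M / c)).
have a0 : 0 < a by rewrite mulr_gt0// expR_gt0.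
have ar : a <= r.
  rewrite ger_pMr// expR_le1 oppr_le0 divr_ge0//; exact: ltW.
have -> : M%:E = (\int[mu]_(x in `[a, r]) (c * x^-1)%:E)%E.
  rewrite integral_inv_segment// /a lnM ?posrE ?expR_gt0// expRK opprD opprK addrA subrr add0r.
  by rewrite mulrC divfK// gt_eqF.
have sD : `]0%R, r]%classic `<=` D by apply: subset_itvl; rewrite bnd_simp.
have sr : `[a, r]%classic `<=` `]0%R, r]%classic by apply: subset_itvr; rewrite bnd_simp.
have f0 x : `]0%R, r]%classic x -> (0 <= (f x)%:E)%E.
  rewrite /= in_itv/= lee_fin => /andP[x0 xr]; apply: le_trans (cf _ x0 xr).
  by rewrite mulr_ge0 ?invr_ge0 ?ltW.
have mfr : measurable_fun `]0%R, r]%classic (EFin \o f).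
  by apply/measurable_EFinP; exact: measurable_funS mf.
apply: (@le_trans _ _ (\int[mu]_(x in `[a, r]) (f x)%:E)%E).
  apply: ge0_le_integral => //.
  - move=> x /sr/= ; rewrite in_itv/= lee_fin => /andP[x0 _].
    by rewrite mulr_ge0 ?invr_ge0 ?ltW.
  - by apply: (measurable_funS _ _ (measurable_inv_pos c)) => //; exact: subset_trans sD.
  - exact: measurable_funS mfr.
  - by move=> x /sr/=; rewrite in_itv/= lee_fin => /andP[x0 xr]; exact: cf.
exact: ge0_subset_integral.
Qed.

Lemma integral_ge_invy (f : R -> R) c (r : R) : 0 < c -> 0 < r ->
  measurable_fun D f ->
  (forall x, r <= x -> c * x^-1 <= f x) ->
  (\int[mu]_(x in `[r, +oo[) (f x)%:E = +oo)%E.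
Proof.
move=> c0 r0 mf cf; apply: integral_pinfty => M M0.
pose b : R := r * expR (M / c).
have rb : r <= b.
  by rewrite ler_pMr// -expR0 ler_expR divr_ge0//; exact: ltW.
have -> : M%:E = (\int[mu]_(x in `[r, b]) (c * x^-1)%:E)%E.
  rewrite integral_inv_segment// /b lnM ?posrE ?expR_gt0// expRK addrAC subrr add0r.
  by rewrite mulrC divfK// gt_eqF.
have sD : `[r, +oo[%classic `<=` D by apply: subset_itvr; rewrite bnd_simp.
have sr : `[r, b]%classic `<=` `[r, +oo[%classic by apply: subset_itvl; rewrite bnd_simp.
have i0 x : r <= x -> 0 <= c * x^-1.
  by move=> rx; rewrite mulr_ge0 ?invr_ge0 ?ltW// (lt_le_trans r0).
have f0 x : `[r, +oo[%classic x -> (0 <= (f x)%:E)%E.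
  rewrite /= in_itv/= lee_fin andbT => xr; apply: le_trans (cf _ xr); exact: i0.
have mfr : measurable_fun `[r, +oo[%classic (EFin \o f).
  by apply/measurable_EFinP; exact: measurable_funS mf.
apply: (@le_trans _ _ (\int[mu]_(x in `[r, b]) (f x)%:E)%E).
  apply: ge0_le_integral => //.
  - by move=> x /sr/= ; rewrite in_itv/= lee_fin andbT; exact: i0.
  - by apply: (measurable_funS _ _ (measurable_inv_pos c)) => //; exact: subset_trans sD.
  - exact: measurable_funS mfr.
  - by move=> x /sr/=; rewrite in_itv/= lee_fin andbT; exact: cf.
exact: ge0_subset_integral.
Qed.

Lemma gig_mass_ge0 q a b : (0 <= gig_mass q a b)%E.
Proof. by apply: integral_ge0 => x _; rewrite lee_fin ltW// gig_kernel_gt0. Qed.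

(** On []0, 1]] the logarithm is nonpositive, so [x^q] is at least [x^-1], while the other factor is
    at least [expR (- a)]. *)
Lemma gig_mass0_pinfty q a : q <= -1 -> 0 <= a -> gig_mass q a 0 = +oo%E.
Proof.
move=> q1 a0.
have : (\int[mu]_(x in `]0%R, 1%R]) (gig_kernel q a 0 x)%:E = +oo)%E.
  apply: (integral_ge_inv0 _ (expR (- a))); rewrite ?expR_gt0//.
    exact: measurable_gig_kernel.
  move=> x x0 x1; rewrite -[X in _ * X^-1]lnK ?posrE// -expRN -expRD ler_expR.
  rewrite /gig_exponent mul0r subr0.
  have := ln_le0 x1; nra.
move=> h; apply/eqP; rewrite -leye_eq -h; apply: ge0_subset_integral => //.
- by apply/measurable_EFinP; exact: measurable_gig_kernel.
- by move=> x _; rewrite lee_fin ltW// gig_kernel_gt0.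
- by apply: subset_itvl; rewrite bnd_simp.
Qed.

Lemma gig_mass_le q a b q' a' b' (K : R) :
  (forall x, 0 < x -> gig_exponent q a b x <= K + gig_exponent q' a' b' x) ->
  (gig_mass q a b <= (expR K)%:E * gig_mass q' a' b')%E.
Proof.
move=> h; rewrite /gig_mass -ge0_integralZl//; last 2 first.
- by apply/measurable_EFinP; exact: measurable_gig_kernel.
- by move=> x _; rewrite lee_fin ltW// gig_kernel_gt0.
apply: ge0_le_integral => //.
- by move=> x _; rewrite lee_fin ltW// gig_kernel_gt0.
- by apply/measurable_EFinP; exact: measurable_gig_kernel.
- by apply/measurable_EFinP; apply: measurable_funM => //; exact: measurable_gig_kernel.
- move=> x; rewrite /= in_itv/= andbT => x0.
  by rewrite lee_fin /gig_kernel -expRD ler_expR h.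
Qed.

(* Comparison with the derivative of the bounded increasing function
   [(x / (1 + x)) `^ (q + 1)] *)
Lemma gig_mass0_lty q a : -1 < q -> 0 < a -> (gig_mass q a 0 < +oo)%E.
Proof.
move=> q1 a0; pose p := q + 1; have p0 : 0 < p by rewrite /p; lra.
pose L x : R := ln x - ln (1 + x).
pose F x : R := expR (p * L x).
pose f x : R := F x * (p * (x^-1 - (1 + x)^-1)).
have p1 : 0 < p + 1 by lra.
(* The slope [a / (p + 1)] yields [(p + 1) * ln (1 + x) <= a * x + K]: the factor [(1 + x)^-(p + 1)]
   of the derivative [f] dominates [expR (- a * x)] up to [expR (- K)]. *)
have [C C0 HC] := @ln_le_linear R (a / (p + 1)) (divr_gt0 a0 p1).
pose K := a + (p + 1) * C.
have f_ge x : 0 < x -> (p * expR (- K)) * gig_kernel q a 0 x <= f x.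
  move=> x0; have x10 : 0 < 1 + x by lra.
  have -> : f x = p * expR (q * ln x - (p + 1) * ln (1 + x)).
    rewrite /f /F /L; have -> : x^-1 - (1 + x)^-1 = x^-1 * (1 + x)^-1.
      by field; rewrite !gt_eqF.
    rewrite -[X in X^-1 * _]lnK ?posrE// -[X in _ * X^-1]lnK ?posrE// -!expRN.
    rewrite mulrCA -!expRD; congr (_ * expR _); rewrite /p; ring.
  rewrite -mulrA ler_pM2l// -expRD ler_expR /gig_exponent mul0r subr0.
  have := HC _ x10; rewrite -(ler_pM2l p1) => h.
  have e : (p + 1) * (a / (p + 1) * (1 + x) + C) = a * (1 + x) + (p + 1) * C.
    by field; rewrite gt_eqF.
  rewrite e in h; rewrite /K; lra.
have c0 : 0 < p * expR (- K) by rewrite mulr_gt0// expR_gt0.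
have : ((p * expR (- K))%:E * gig_mass q a 0 <= 1)%E.
  rewrite /gig_mass -ge0_integralZl//; last 3 first.
  - by apply/measurable_EFinP; exact: measurable_gig_kernel.
  - by move=> x _; rewrite lee_fin ltW// gig_kernel_gt0.
  - by rewrite lee_fin ltW.
  have cf x : 0 < x -> {for x, continuous f}.
    move=> x0; have x10 : 0 < 1 + x by lra.
    have cx : (1 + y) @[y --> x] --> 1 + x by apply: cvgD; [exact: cvg_cst|exact: cvg_id].
    apply: cvgM.
      apply: continuous_comp; last exact: continuous_expR.
      apply: cvgMr; apply: cvgB; first exact: continuous_ln.
      by apply: (continuous_comp cx); exact: continuous_ln.
    apply: cvgMr; apply: cvgB; apply: cvgV; rewrite ?gt_eqF//; exact: cvg_id.
  have mf : measurable_fun D (EFin \o f).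
    by apply/measurable_EFinP; exact: continuous_measurable_pos.
  have f0 x : 0 < x -> (0 <= (f x)%:E)%E.
    move=> x0; rewrite lee_fin; apply: le_trans (f_ge _ x0).
    by rewrite mulr_ge0// ltW// gig_kernel_gt0.
  apply: (@le_trans _ _ (\int[mu]_(x in D) (f x)%:E)%E).
    apply: ge0_le_integral => //.
    - by move=> x _; rewrite lee_fin mulr_ge0 ?ltW// gig_kernel_gt0.
    - by apply/measurable_EFinP; apply: measurable_funM => //; exact: measurable_gig_kernel.
    - by move=> x; rewrite /= in_itv/= andbT lee_fin; exact: f_ge.
  apply: (integral_exhaust_le 1) => // n.
  have n0 : 0 < n.+1%:R :> R by rewrite ltr0n.
  have n1 : (1 : R) / n.+1%:R <= 1 * n.+1%:R.
    by rewrite !mul1r (@le_trans _ _ 1)// ?invf_le1// ?ler1n.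
  have dF (x : R) : 0 < x -> is_derive x 1 F (f x).
    move=> x0; have x10 : 0 < 1 + x by lra.
    have h1 := @is_derive1_ln R _ x0.
    have h2 : is_derive x 1 (fun y : R => ln (1 + y)) ((1 + x)^-1 * (0 + 1)).
      have h := is_deriveD (is_derive_cst (1 : R) x (1 : R)) (is_derive_id x (1 : R)).
      exact: (@is_derive1_comp R (@ln R) (cst 1 + id) _ _ _ (is_derive1_ln x10) h).
    have h3 := @is_deriveZ _ _ _ _ p _ _ _ (is_deriveB h1 h2).
    have h4 := is_derive1_comp (is_derive_expR _) h3.
    apply: (is_derive_eq (h4 : is_derive x 1 F _)).
    by rewrite /f /F /L /GRing.scale/= add0r mulr1.
  have n2 : (0 : R) < 1 / n.+1%:R by rewrite divr_gt0.
  rewrite /exhaust (continuous_FTC2_pos _ _ _ _ n2 n1 dF cf).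
  rewrite lee_fin lerBlDr (@le_trans _ _ 1)//; last by rewrite lerDl expR_ge0.
  rewrite /F expR_le1 pmulr_rle0// /L subr_le0 mul1r.
  by rewrite ler_ln ?posrE ?lerDr// addr_gt0.
have := gig_mass_ge0 q a 0; case: (gig_mass q a 0) => //= [r|].
  by rewrite ltry.
by rewrite gt0_muley ?lte_fin.
Qed.

End gig_mass.

(** * Differentiation under the integral for one-parameter exponential families *)

Section exp_family.
Context {R : realType} {d : measure_display} {T : measurableType d}.
Variables (mu : {measure set T -> \bar R}) (D : set T).
Hypothesis mD : measurable D.
Implicit Types (A L : T -> R) (s t delta : R).

(** The exponent is affine in [s], so its exponential is at most the larger of the two endpoint
    values, hence at most their sum. *)
Lemma expRD_le_sum (A l s s0 delta : R) : `|s - s0| <= delta ->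
  expR (A + s * l) <= expR (A + (s0 + delta) * l) + expR (A + (s0 - delta) * l).
Proof.
rewrite ler_norml => /andP[h1 h2].
have e1 := expR_ge0 (A + (s0 + delta) * l).
have e2 := expR_ge0 (A + (s0 - delta) * l).
case: (leP 0 l) => l0.
- have : expR (A + s * l) <= expR (A + (s0 + delta) * l) by rewrite ler_expR; nra.
  lra.
- have : expR (A + s * l) <= expR (A + (s0 - delta) * l) by rewrite ler_expR; nra.
  lra.
Qed.

(** The margin [delta] is split in two: one half absorbs the factor [l], by [|l| <= 2 / delta * expR
    (delta / 2 * |l|)], the other lets [s] move around [s0]. *)
Lemma norm_expRM_le (A l s s0 delta : R) : 0 < delta -> `|s - s0| <= delta / 2 ->
  `|expR (A + s * l) * l| <=
  2 / delta * (expR (A + (s0 + delta) * l) + expR (A + (s0 - delta) * l)).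
Proof.
move=> d0 sd.
have d2 : 0 < delta / 2 by lra.
have h1 : `|l| <= 2 / delta * expR (delta / 2 * `|l|).
  have := expR_ge1Dx (delta / 2 * `|l|) => h.
  by rewrite -ler_pdivrMl ?divr_gt0// invf_div; lra.
rewrite normrM ger0_norm ?expR_ge0//.
apply: (@le_trans _ _ (expR (A + s * l) * (2 / delta * expR (delta / 2 * `|l|)))).
  by rewrite ler_pM2l ?expR_gt0.
rewrite mulrCA ler_pM2l ?divr_gt0// -expRD.
move: sd; rewrite ler_norml => /andP[s1 s2].
have e1 := expR_ge0 (A + (s0 + delta) * l).
have e2 := expR_ge0 (A + (s0 - delta) * l).
case: (ger0P l) => l0.
- have : expR (A + s * l + delta / 2 * l) <= expR (A + (s0 + delta) * l).
    have : 0 <= (s0 - s + delta / 2) * l by apply: mulr_ge0 => //; lra.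
    rewrite ler_expR; lra.
  lra.
- have : expR (A + s * l + delta / 2 * - l) <= expR (A + (s0 - delta) * l).
    have : 0 <= (s - s0 + delta / 2) * - l by apply: mulr_ge0; lra.
    rewrite ler_expR; lra.
  lra.
Qed.

Variables (A L : T -> R) (s0 delta : R).
Hypotheses (mA : measurable_fun D A) (mL : measurable_fun D L) (delta0 : 0 < delta).
Hypothesis intD : mu.-integrable D (fun x => (expR (A x + (s0 + delta) * L x))%:E).
Hypothesis intB : mu.-integrable D (fun x => (expR (A x + (s0 - delta) * L x))%:E).

Let measurable_exp s : measurable_fun D (fun x => expR (A x + s * L x)).
Proof.
apply: measurableT_comp => //; apply: measurable_funD => //.
exact: measurable_funM.
Qed.

Lemma exp_family_integrable s : `|s - s0| <= delta ->
  mu.-integrable D (fun x => (expR (A x + s * L x))%:E).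
Proof.
move=> sd; apply: (le_integrable mD _ _ (integrableD mD intD intB)).
- exact/measurable_EFinP.
- move=> x _; rewrite /= lee_fin !ger0_norm ?expR_ge0 ?addr_ge0 ?expR_ge0//.
  exact: expRD_le_sum.
Qed.

Let dominant x := 2 / delta * (expR (A x + (s0 + delta) * L x) + expR (A x + (s0 - delta) * L x)).

Let dominant_ge0 x : 0 <= dominant x.
Proof. by rewrite mulr_ge0 ?addr_ge0 ?expR_ge0 ?divr_ge0// ltW. Qed.

Let integrable_dominant : mu.-integrable D (fun x => (dominant x)%:E).
Proof.
rewrite /dominant; under eq_fun do rewrite EFinM EFinD.
by apply: integrableZl => //; exact: integrableD.
Qed.

Lemma exp_family_integrableM : mu.-integrable D (fun x => (expR (A x + s0 * L x) * L x)%:E).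
Proof.
apply: (le_integrable mD _ _ integrable_dominant).
- by apply/measurable_EFinP; exact: measurable_funM.
- move=> x _; rewrite /= lee_fin [leRHS]ger0_norm//.
  by apply: norm_expRM_le => //; rewrite subrr normr0 divr_ge0// ltW.
Qed.

(** The derivative of the integrand has a bound that is uniform for [s] within [delta / 2] of [s0],
    integrable by the hypotheses at the two endpoints. *)
Lemma is_derive_exp_family :
  is_derive s0 1 (fun s => (\int[mu]_(x in D) expR (A x + s * L x))%R)
    (\int[mu]_(x in D) (expR (A x + s0 * L x) * L x))%R.
Proof.
pose f s x := expR (A x + s * L x).
have df s x : is_derive s 1 (f ^~ x) (expR (A x + s * L x) * L x).
  have h1 := @is_deriveZ _ _ _ _ (L x) _ _ _ (is_derive_id s (1 : R)).
  have h2 := is_deriveD (is_derive_cst (A x) s (1 : R)) h1.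
  have h3 := is_derive1_comp (is_derive_expR _) h2.
  have e : expR \o (cst (A x) + L x \*: id) = f ^~ x.
    by apply/funext => t; rewrite /f /= mulrC.
  rewrite e in h3; apply: (is_derive_eq h3).
  by rewrite /GRing.scale/= add0r mulr1 /cst fctE /= /GRing.scale/= (mulrC s).
pose u := s0 - delta / 2; pose v := s0 + delta / 2.
have d2 : 0 < delta / 2 by rewrite divr_gt0.
have Iu s : `]u, v[%classic s -> `|s - s0| <= delta / 2.
  rewrite /u /v /= in_itv/= ler_norml => /andP[h1 h2]; apply/andP; split; lra.
have I0 : `]u, v[%classic s0 by rewrite /u /v /= in_itv/=; apply/andP; split; lra.
have intf s : `]u, v[%classic s -> mu.-integrable D (EFin \o f s).
  by move=> /Iu h; apply: exp_family_integrable; lra.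
have derf s x : `]u, v[%classic s -> D x -> derivable (f ^~ x) s 1.
  by move=> _ _; have [] := df s x.
have ub s x : `]u, v[%classic s -> D x -> `|partial1of2 f s x| <= dominant x.
  move=> /Iu h _; rewrite partial1of2E (@derive_val _ _ _ _ _ _ _ (df s x)).
  exact: norm_expRM_le.
have h1 := derivable_under_integral mD I0 intf derf dominant_ge0 integrable_dominant ub.
have h2 := differentiation_under_integral mD I0 intf derf dominant_ge0 integrable_dominant ub.
apply: DeriveDef => //; rewrite -derive1E h2.
apply: eq_Rintegral => x _.
by rewrite partial1of2E (@derive_val _ _ _ _ _ _ _ (df s0 x)).
Qed.

End exp_family.

(** * Finiteness of the mass and one-sided limits in [(a, b)] *)

Section gig_continuity.
Context {R : realType}.
Implicit Types (q a b c x : R).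
Notation mu := (@lebesgue_measure R).
Notation D := (`]0%R, +oo[%classic : set R).

(** One integrability condition per end: at infinity, exponential decay or a power below -1; at 0,
    exponential decay or a power above -1. *)
Definition gig_proper q a b : Prop :=
  [/\ 0 <= a, 0 <= b, 0 < a \/ q < -1 & 0 < b \/ -1 < q].

(** The inversion [x |-> 1 / x] exchanges the two ends of the half-line, so that each boundary case
    is studied at one end only. *)
Lemma gig_mass_swap q a b : gig_mass q a b = gig_mass (- q - 2) b a.
Proof. by rewrite (gig_mass_inversion _ _ _ 1)// ln1 mulr0 expR0 mul1e divr1 mulr1. Qed.

Lemma gig_mass_lty q a b : gig_proper q a b -> (gig_mass q a b < +oo)%E.
Proof.
suff main q' a' b' : gig_proper q' a' b' -> 0 < a' -> (gig_mass q' a' b' < +oo)%E.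
  move=> qab; have [a0 b0 aq bq] := qab; have [a1|a1] := ltP 0 a; first exact: main.
  have e : a = 0 by apply/eqP; rewrite eq_le a1 a0.
  have {}aq : q < -1 by case: aq => //; rewrite e ltxx.
  have b1 : 0 < b by case: bq => //; lra.
  rewrite gig_mass_swap; apply: main => //; split => //; first by left.
  by right; lra.
move=> [_ b0 _ bq] a0; have [b1|b1] := ltP 0 b'; last first.
  have e : b' = 0 by apply/eqP; rewrite eq_le b1 b0.
  rewrite e; apply: gig_mass0_lty => //; case: bq => //; by rewrite e ltxx.
have qq : 0 <= `|q'| - q' by rewrite subr_ge0 ler_norm.
(* Slope for bounding [- ln x] by [e / x], small enough that [(|q'| - q') * e <= b']; the added 1
   keeps the denominator positive when [q' >= 0]. *)
pose e := b' / (`|q'| - q' + 1).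
have q1 : 0 < `|q'| - q' + 1 by lra.
have e0 : 0 < e by exact: divr_gt0.
have eb : (`|q'| - q') * e <= b'.
  have -> : b' = (`|q'| - q' + 1) * e by rewrite /e mulrC divfK// gt_eqF.
  by rewrite ler_pM2r//; lra.
have [C C0 HC] := ln_le_linear _ e0.
have q2 : -1 < `|q'| by apply: lt_le_trans (normr_ge0 _).
have := gig_mass0_lty _ _ q2 a0.
have H x : 0 < x -> gig_exponent q' a' b' x <= (`|q'| - q') * C + gig_exponent `|q'| a' 0 x.
  move=> x0; have x1 : 0 < x^-1 by rewrite invr_gt0.
  have := HC _ x1; rewrite lnV ?posrE// /gig_exponent mul0r subr0 => h.
  have h1 : (`|q'| - q') * - ln x <= (`|q'| - q') * (e * x^-1 + C) by exact: ler_wpM2l.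
  have h2 : (`|q'| - q') * e * x^-1 <= b' * x^-1 by rewrite ler_pM2r.
  lra.
move=> fin; apply: le_lt_trans (gig_mass_le _ _ _ _ _ _ _ H) _.
have := gig_mass_ge0 `|q'| a' 0; move: fin; case: (gig_mass _ _ _) => //= r _ _.
by rewrite -EFinM ltry.
Qed.

(** This turns finiteness of the speed measure into a condition on the parameters: if [b = 0], the
    power alone decides integrability at 0, and [a = 0] is the same case after the swap. *)
Lemma gig_mass_lty_proper q a b : 0 <= a -> 0 <= b -> 0 < a \/ 0 < b ->
  (gig_mass q a b < +oo)%E -> gig_proper q a b.
Proof.
move=> a0 b0 ab fin; split => //.
- have [a1|a1] := ltP 0 a; first by left.
  have e : a = 0 by apply/eqP; rewrite eq_le a1 a0.
  right; rewrite ltNge; apply/negP => q1; move: fin.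
  by rewrite gig_mass_swap e gig_mass0_pinfty ?ltxx//; lra.
- have [b1|b1] := ltP 0 b; first by left.
  have e : b = 0 by apply/eqP; rewrite eq_le b1 b0.
  right; rewrite ltNge; apply/negP => q1; move: fin.
  by rewrite e gig_mass0_pinfty ?ltxx.
Qed.

(** A zero integral would make the positive kernel vanish almost everywhere and put the half-line,
    of infinite measure, inside a null set. *)
Lemma gig_mass_gt0 q a b : (0 < gig_mass q a b)%E.
Proof.
rewrite lt_neqAle gig_mass_ge0 andbT eq_sym; apply/eqP => h.
have mk : measurable_fun D (EFin \o gig_kernel q a b).
  by apply/measurable_EFinP; exact: measurable_gig_kernel.
have mD : measurable D by exact: measurable_itv.
have k0 x : (0 <= (EFin \o gig_kernel q a b) x)%E by rewrite lee_fin ltW// gig_kernel_gt0.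
have := ae_eq_integral_abs mu mD mk.
have -> : (\int[mu]_(x in D) `|(EFin \o gig_kernel q a b) x| = gig_mass q a b)%E.
  by apply: eq_integral => x _; rewrite gee0_abs.
move=> [/(_ h) + _] => -[N [mN N0 sN]].
have : (mu D <= mu N)%E.
  apply: le_measure; rewrite ?inE// => x Dx; apply: sN => /= /(_ Dx) [] /eqP.
  by rewrite gt_eqF// gig_kernel_gt0.
by rewrite N0 lebesgue_measure_itv/= ltry.
Qed.

Lemma gig_proper_near q a b : gig_proper q a b ->
  exists2 delta : R, 0 < delta < 1 &
    forall t, `|t - 1| <= delta -> gig_proper (t * q) (t * a) (t * b).
Proof.
move=> [a0 b0 aq bq].
(* At the critical power neither end can rely on [q], so [a] and [b] are both positive and any
   margin below 1 works. *)
have [q1|q1] := eqVneq q (-1).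
  have {}aq : 0 < a by case: aq => //; rewrite q1 ltxx.
  have {}bq : 0 < b by case: bq => //; rewrite q1 ltxx.
  exists 2^-1; first by apply/andP; split; lra.
  move=> t; rewrite ler_norml => /andP[t1 t2]; have t0 : 0 < t by lra.
  by split; rewrite ?(mulr_ge0 (ltW t0))//; left; exact: mulr_gt0.
(* Keeps [|(t - 1) * q|] below half the distance from [q] to -1, so that [t * q] stays on the same
   side of -1; as [|q + 1| <= |q| + 1], it is below 1 and [t] stays positive. *)
pose del := `|q + 1| / (2 * (`|q| + 1)).
have n0 := normr_ge0 q.
have p0 : 0 < `|q| + 1 by lra.
have p1 : 0 < `|q + 1| by rewrite normr_gt0 addr_eq0.
have del0 : 0 < del by rewrite divr_gt0// mulr_gt0.
have dele : del * (`|q| + 1) = `|q + 1| / 2 by rewrite /del; field; rewrite gt_eqF.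
have del1 : del < 1.
  have := ler_normD q 1; rewrite normr1 => h.
  by rewrite /del ltr_pdivrMr ?mulr_gt0//; lra.
exists del; first by rewrite del0.
move=> t td; have := td; rewrite ler_norml => /andP[t1 t2]; have t0 : 0 < t by lra.
have : `|(t - 1) * q| <= `|q + 1| / 2.
  rewrite normrM -dele; apply: (@le_trans _ _ (del * `|q|)); first exact: ler_wpM2r.
  by rewrite ler_pM2l//; lra.
rewrite ler_norml => /andP[h1 h2].
split; rewrite ?(mulr_ge0 (ltW t0))//.
- case: aq => [aq|aq]; first by left; exact: mulr_gt0.
  right; move: h2; rewrite ltr0_norm; lra.
- case: bq => [bq|bq]; first by left; exact: mulr_gt0.
  right; move: h1; rewrite gtr0_norm; lra.
Qed.

Lemma gig_exponentZ t q a b x :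
  gig_exponent (t * q) (t * a) (t * b) x = t * gig_exponent q a b x.
Proof. by rewrite /gig_exponent !mulrBr !mulrA. Qed.

Lemma gig_exponent_antitone q a b a' b' x : 0 < x -> a <= a' -> b <= b' ->
  gig_exponent q a' b' x <= gig_exponent q a b x.
Proof.
move=> x0 aa bb; rewrite /gig_exponent; apply: lerB; first apply: lerB => //.
- by rewrite ler_pM2r.
- by rewrite ler_pM2r// invr_gt0.
Qed.

Lemma gig_mass_antitone q a b a' b' : a <= a' -> b <= b' ->
  (gig_mass q a' b' <= gig_mass q a b)%E.
Proof.
move=> aa bb; apply: ge0_le_integral => //.
- by move=> x _; rewrite lee_fin ltW// gig_kernel_gt0.
- by apply/measurable_EFinP; exact: measurable_gig_kernel.
- by apply/measurable_EFinP; exact: measurable_gig_kernel.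
- move=> x; rewrite /= in_itv/= andbT => x0.
  by rewrite lee_fin ler_expR gig_exponent_antitone.
Qed.

Lemma gig_kernel_integrable q a b : gig_proper q a b ->
  mu.-integrable D (EFin \o gig_kernel q a b).
Proof.
move=> ok; apply/integrableP; split.
  by apply/measurable_EFinP; exact: measurable_gig_kernel.
have -> : (\int[mu]_(x in D) `|(EFin \o gig_kernel q a b) x| = gig_mass q a b)%E.
  by apply: eq_integral => x _; rewrite gee0_abs// lee_fin ltW// gig_kernel_gt0.
exact: gig_mass_lty.
Qed.

Lemma cvg_gig_exponent (T : Type) (F : set_system T) {FF : Filter F}
    (u v : T -> R) q a b x :
  u @ F --> a -> v @ F --> b -> gig_exponent q (u n) (v n) x @[n --> F] --> gig_exponent q a b x.
Proof.
move=> ua vb; apply: cvgB; last exact: cvgMl.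
by apply: cvgB; [exact: cvg_cst|exact: cvgMl].
Qed.

Lemma cvg_gig_kernel (T : Type) (F : set_system T) {FF : Filter F}
    (u v : T -> R) q a b x :
  u @ F --> a -> v @ F --> b -> gig_kernel q (u n) (v n) x @[n --> F] --> gig_kernel q a b x.
Proof.
move=> ua vb; have h := @cvg_gig_exponent T F FF u v q a b x ua vb.
have h2 := cvg_comp _ _ h (@continuous_expR R _).
exact: h2.
Qed.

(* The boundary limits [b -> 0] and [a -> 0] are the cases [(i, j) = (0, 1)]
   and [(i, j) = (1, 0)] *)
Lemma gig_mass_cvg q a b (i j : R) : 0 <= i -> 0 <= j ->
  gig_mass q (a + i * e) (b + j * e) @[e --> 0^'+] --> gig_mass q a b.
Proof.
move=> i0 j0.
pose F e := gig_mass q (a + i * e) (b + j * e).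
have nF : {in `]0, +oo[ &, nonincreasing_fun F}.
  move=> x y _ _ xy; apply: gig_mass_antitone; rewrite lerD2l; exact: ler_wpM2l.
(* Being monotone in [e], the mass tends to its supremum over [e > 0], finite or not; monotone
   convergence along [e = 1 / (n + 1)] identifies that supremum. *)
have h := @nonincreasing_at_right_cvge R F 0 (BInfty _ false) isT nF.
suff -> : gig_mass q a b = ereal_sup [set F x | x in `]0, +oo[] by exact: h.
apply/eqP; rewrite eq_le; apply/andP; split; last first.
  apply: ge_ereal_sup => _ [x /= + <-]; rewrite in_itv/= andbT => /ltW x0.
  by apply: gig_mass_antitone; rewrite lerDl mulr_ge0.
pose u n : R := n.+1%:R^-1.
have u0 n : 0 < u n by rewrite invr_gt0.
have cu : u @ \oo --> 0 by exact: cvg_harmonic.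
pose g n x := (gig_kernel q (a + i * u n) (b + j * u n) x)%:E.
have cvg_add (r k : R) : r + k * u n @[n --> \oo] --> r.
  by rewrite -[X in _ --> X]addr0 -[X in _ + X](mulr0 k); apply: cvgD;
    [exact: cvg_cst|exact: cvgMr].
have gk x : D x -> limn (g ^~ x) = (gig_kernel q a b x)%:E.
  move=> Dx; apply/cvg_lim => //; apply: cvg_EFin; first exact: nearW.
  exact: (@cvg_gig_kernel _ _ _ _ _ q _ _ x (cvg_add a i) (cvg_add b j)).
have cg := @cvg_monotone_convergence _ _ R mu D (measurable_itv _) g.
have {cg} : (\int[mu]_(x in D) g n x @[n --> \oo] --> \int[mu]_(x in D) limn (g ^~ x))%E.
  apply: cg.
  - by move=> n; apply/measurable_EFinP; exact: measurable_gig_kernel.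
  - by move=> n x _; rewrite lee_fin ltW// gig_kernel_gt0.
  - move=> x; rewrite /= in_itv/= andbT => x0 m n mn.
    rewrite lee_fin ler_expR; apply: gig_exponent_antitone => //; rewrite lerD2l ler_wpM2l//;
    by rewrite lef_pV2 ?posrE// ler_nat.
have -> : (\int[mu]_(x in D) limn (g ^~ x) = gig_mass q a b)%E.
  by apply: eq_integral => x; rewrite inE => /gk.
move=> cg; rewrite -(cvg_lim _ cg)//; apply: lime_le.
  by apply/cvg_ex; eexists; exact: cg.
apply: nearW => n; apply: ereal_sup_ubound; exists (u n) => //=.
by rewrite in_itv/= andbT.
Qed.

Lemma exp_family_gig_exponent q a b (t : R) x :
  expR (0 + t * gig_exponent q a b x) = gig_kernel (t * q) (t * a) (t * b) x.
Proof. by rewrite add0r /gig_kernel gig_exponentZ. Qed.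

(** The exponential family with [A = 0], [L] the exponent and [s0 = 1], whose members are the
    kernels along the ray. *)
Lemma gig_entropy_integrable q a b : gig_proper q a b ->
  mu.-integrable D (fun x => (gig_kernel q a b x * gig_exponent q a b x)%:E).
Proof.
move=> /gig_proper_near[del /andP[d0 d1] H].
have h := @exp_family_integrableM R _ _ mu D (measurable_itv _) (cst 0)
  (gig_exponent q a b) 1 del (measurable_cst _) (measurable_gig_exponent q a b) d0.
have e x : gig_kernel q a b x * gig_exponent q a b x =
    expR (cst 0 x + 1 * gig_exponent q a b x) * gig_exponent q a b x.
  by rewrite /= exp_family_gig_exponent !mul1r.
have -> : (fun x => (gig_kernel q a b x * gig_exponent q a b x)%:E) =
    (fun x => (expR (cst 0 x + 1 * gig_exponent q a b x) * gig_exponent q a b x)%:E).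
  by apply/funext => x; rewrite e.
have k (t : R) : `|t - 1| <= del ->
    mu.-integrable D (fun x => (expR (cst 0 x + t * gig_exponent q a b x))%:E).
  move=> /H ok; rewrite (_ : (fun x => _) = EFin \o gig_kernel (t * q) (t * a) (t * b)).
    exact: gig_kernel_integrable.
  by apply/funext => x; rewrite /= exp_family_gig_exponent.
apply: h; apply: k.
- by rewrite addrAC subrr add0r gtr0_norm.
- by rewrite addrAC subrr add0r normrN gtr0_norm.
Qed.

Lemma gig_entropy_cvg q a b (i j : R) : gig_proper q a b -> 0 <= i -> 0 <= j ->
  (\int[mu]_(x in D) (gig_kernel q (a + i * e) (b + j * e) x * gig_exponent q (a + i * e) (b + j * e) x)%R)%R
     @[e --> 0^'+] -->
  (\int[mu]_(x in D) (gig_kernel q a b x * gig_exponent q a b x)%R)%R.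
Proof.
(* Dominated convergence is applied along sequences; the bound [G] is taken at the limiting
   parameters and does not depend on [n]. *)
move=> ok i0 j0; apply/cvg_at_rightP => u [u0 cu].
have [del /andP[d0 d1] H] := gig_proper_near _ _ _ ok.
pose G x : R := 2 / del * (gig_kernel ((1 + del) * q) ((1 + del) * a) ((1 + del) * b) x +
   gig_kernel ((1 - del) * q) ((1 - del) * a) ((1 - del) * b) x).
have intG : mu.-integrable D (EFin \o G).
  have -> : EFin \o G = (fun x => ((2 / del)%:E *
      ((gig_kernel ((1 + del) * q) ((1 + del) * a) ((1 + del) * b) x)%:E +
       (gig_kernel ((1 - del) * q) ((1 - del) * a) ((1 - del) * b) x)%:E))%E).
    by apply/funext => x; rewrite /G /= EFinM EFinD.
  apply: integrableZl => //; apply: integrableD => //; apply: gig_kernel_integrable; apply: H.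
  - by rewrite addrAC subrr add0r gtr0_norm.
  - by rewrite addrAC subrr add0r normrN gtr0_norm.
have mf q' a' b' : measurable_fun D (fun x => (gig_kernel q' a' b' x * gig_exponent q' a' b' x)%:E).
  apply/measurable_EFinP; apply: measurable_funM.
    exact: measurable_gig_kernel.
  exact: measurable_gig_exponent.
pose f n x : \bar R := (gig_kernel q (a + i * u n) (b + j * u n) x * gig_exponent q (a + i * u n) (b + j * u n) x)%:E.
have cvg_add (r k : R) : r + k * u n @[n --> \oo] --> r.
  by rewrite -[X in _ --> X]addr0 -[X in _ + X](mulr0 k); apply: cvgD;
    [exact: cvg_cst|exact: cvgMr].
have ff x : D x -> f n x @[n --> \oo] --> (gig_kernel q a b x * gig_exponent q a b x)%:E.
  move=> _; apply: cvg_EFin; first exact: nearW.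
  have ce : gig_exponent q (a + i * u n) (b + j * u n) x @[n --> \oo] --> gig_exponent q a b x.
    exact: (@cvg_gig_exponent _ _ _ _ _ q _ _ x (cvg_add a i) (cvg_add b j)).
  have ck : gig_kernel q (a + i * u n) (b + j * u n) x @[n --> \oo] --> gig_kernel q a b x.
    exact: (@cvg_gig_kernel _ _ _ _ _ q _ _ x (cvg_add a i) (cvg_add b j)).
  exact: (cvgM ck ce).
have fG n x : D x -> (`|f n x| <= (EFin \o G) x)%E.
  rewrite /= in_itv/= andbT => x0; rewrite lee_fin.
  have i1 : 0 <= i * u n by rewrite mulr_ge0// ltW.
  have j1 : 0 <= j * u n by rewrite mulr_ge0// ltW.
  have := norm_expRM_le 0 (gig_exponent q (a + i * u n) (b + j * u n) x) 1 1 del d0.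
  rewrite subrr normr0 add0r mul1r => /(_ _)/le_trans; apply; first by lra.
  rewrite ler_pM2l ?divr_gt0//; apply: lerD; rewrite add0r ler_expR gig_exponentZ ler_pM2l;
    rewrite ?gig_exponent_antitone ?lerDl//; lra.
have [|||||_ _] := @dominated_convergence _ _ R mu D (measurable_itv _) f
  (fun x => (gig_kernel q a b x * gig_exponent q a b x)%:E) (EFin \o G).
- by move=> n; exact: mf.
- exact: mf.
- exact: aeW.
- exact: intG.
- by apply: aeW => x n; exact: fG.
set l := integral _ _ _; have lfin : l = (fine l)%:E.
  by rewrite fineK// integrable_fin_num// gig_entropy_integrable.
by rewrite lfin => /fine_cvg.
Qed.

End gig_continuity.

(** * The normalizing constant: recurrence and Bessel form *)

Section gig_information.
Context {R : realType}.
Implicit Types (q a b c x : R).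
Notation mu := (@lebesgue_measure R).
Notation D := (`]0%R, +oo[%classic : set R).

Implicit Types g t z nu alpha : R.

Lemma gig_proper_gt0 q a b : 0 < a -> 0 < b -> gig_proper q a b.
Proof. by move=> a0 b0; split; [exact: ltW|exact: ltW|left|left]. Qed.

(** The value is 0 when the mass is infinite; [gig_proper] excludes this. *)
Definition gig_const q a b : R := fine (gig_mass q a b).

Lemma gig_constE q a b : gig_proper q a b -> (gig_const q a b)%:E = gig_mass q a b.
Proof.
by move=> ok; rewrite fineK// ge0_fin_numE ?gig_mass_ge0 ?gig_mass_lty.
Qed.

Lemma gig_const_gt0 q a b : gig_proper q a b -> 0 < gig_const q a b.
Proof. by move=> ok; rewrite -lte_fin gig_constE// gig_mass_gt0. Qed.

(** Bounds the kernel by a multiple of both [x] and [x^-1]. This kills the boundary terms in the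
    integration by parts and makes the scale density non-integrable at both ends. *)
Lemma gig_exponent_le_ln q a b : 0 < a -> 0 < b ->
  exists K : R, forall x, 0 < x -> gig_exponent q a b x <= K - `|ln x|.
Proof.
move=> a0 b0; pose m := Num.min a b; have m0 : 0 < m by rewrite lt_min a0.
have ma : m <= a by rewrite ge_min lexx.
have mb : m <= b by rewrite ge_min lexx orbT.
have q0 : 0 < `|q| + 1 by rewrite ltr_wpDl.
(* Multiplied by [|q| + 1], this slope becomes [m]; the 1 beyond [|q|] leaves one [|ln x|] to
   spare. *)
have [C C0 H] := norm_ln_le _ (divr_gt0 m0 q0).
exists ((`|q| + 1) * C) => x x0; have x1 : 0 < x^-1 by rewrite invr_gt0.
have := H _ x0; rewrite -(ler_pM2l q0).
have -> : (`|q| + 1) * (m / (`|q| + 1) * x + m / (`|q| + 1) / x + C) =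
   m * x + m * x^-1 + (`|q| + 1) * C by field; rewrite !gt_eqF.
have h1 : m * x <= a * x by rewrite ler_pM2r.
have h2 : m * x^-1 <= b * x^-1 by rewrite ler_pM2r.
have : q * ln x <= `|q| * `|ln x| by rewrite -normrM ler_norm.
rewrite /gig_exponent; lra.
Qed.

Lemma gig_kernel_shift q k a b x : 0 < x ->
  gig_kernel (q + k) a b x = gig_kernel q a b x * expR (k * ln x).
Proof.
by move=> x0; rewrite -expRD; congr expR; rewrite /gig_exponent; ring.
Qed.

Lemma gig_kernelDp q a b x : 0 < x -> gig_kernel (q + 1) a b x = gig_kernel q a b x * x.
Proof. by move=> x0; rewrite gig_kernel_shift// mul1r lnK ?posrE. Qed.

Lemma gig_kernelBp q a b x : 0 < x -> gig_kernel (q - 1) a b x = gig_kernel q a b x * x^-1.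
Proof. by move=> x0; rewrite gig_kernel_shift// mulN1r expRN lnK ?posrE. Qed.

Lemma cvg_integral_exhaust_gig q a b : gig_proper q a b ->
  (\int[mu]_(x in exhaust 1 n) gig_kernel q a b x)%R @[n --> \oo] --> gig_const q a b.
Proof.
move=> ok.
have mk : measurable_fun D (EFin \o gig_kernel q a b).
  by apply/measurable_EFinP; exact: measurable_gig_kernel.
have k0 x : 0 < x -> (0 <= (EFin \o gig_kernel q a b) x)%E.
  by move=> _; rewrite lee_fin ltW// gig_kernel_gt0.
have := integral_exhaust _ _ ltr01 mk k0.
have -> : (\int[mu]_(x in D) (EFin \o gig_kernel q a b) x)%E = (gig_const q a b)%:E.
  by rewrite gig_constE.
exact: fine_cvg.
Qed.

(* Integration by parts: the derivative of [gig_kernel (q + 1) a b] has integral 0 *)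
Lemma gig_const_recurrence q a b : 0 < a -> 0 < b ->
  a * gig_const (q + 1) a b = (q + 1) * gig_const q a b + b * gig_const (q - 1) a b.
Proof.
move=> a0 b0; have ok k := gig_proper_gt0 k a b a0 b0.
pose F := gig_kernel (q + 1) a b.
pose f x := (q + 1) * gig_kernel q a b x - a * gig_kernel (q + 1) a b x + b * gig_kernel (q - 1) a b x.
have dF (x : R) : 0 < x -> is_derive x 1 F (f x).
  move=> x0; apply: (is_derive_eq (is_derive_gig_kernel (q + 1) a b x x0)).
  rewrite /f gig_kernelBp// gig_kernelDp//; field; exact: lt0r_neq0.
have cf (x : R) : 0 < x -> {for x, continuous f}.
  move=> x0; apply: cvgD; first apply: cvgB; apply: cvgMr; exact: continuous_gig_kernel.
have ik n k : mu.-integrable (exhaust 1 n) (EFin \o gig_kernel k a b).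
  have sD : exhaust 1 n `<=` D.
    by rewrite -(bigcup_exhaust _ (@ltr01 R)); exact: bigcup_sup.
  apply: (@integrableS _ _ _ mu D (exhaust 1 n) _ _ _ sD).
  - exact: measurable_itv.
  - exact: measurable_itv.
  - exact: gig_kernel_integrable.
have fE n : (\int[mu]_(x in exhaust 1 n) f x)%R = F (1 * n.+1%:R) - F (1 / n.+1%:R).
  have n1 : (1 : R) / n.+1%:R <= 1 * n.+1%:R.
    by rewrite !mul1r (@le_trans _ _ 1)// ?invf_le1// ?ler1n.
  have n2 : (0 : R) < 1 / n.+1%:R by rewrite divr_gt0.
  by rewrite /Rintegral /exhaust (continuous_FTC2_pos _ _ _ _ n2 n1 dF cf).
have fE' n : (\int[mu]_(x in exhaust 1 n) f x)%R =
   (q + 1) * (\int[mu]_(x in exhaust 1 n) gig_kernel q a b x)%R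
   - a * (\int[mu]_(x in exhaust 1 n) gig_kernel (q + 1) a b x)%R
   + b * (\int[mu]_(x in exhaust 1 n) gig_kernel (q - 1) a b x)%R.
  have mE : measurable (exhaust 1 n : set R) by exact: measurable_itv.
  have iZ r k : mu.-integrable (exhaust 1 n) (EFin \o (fun x => r * gig_kernel k a b x)).
    by rewrite /comp; under eq_fun do rewrite EFinM; apply: integrableZl => //; exact: ik.
  rewrite /f RintegralD//; last first.
    by rewrite /comp; under eq_fun do rewrite EFinB; apply: integrableB => //; exact: iZ.
  by rewrite RintegralB// !RintegralZl.
have c1 : (\int[mu]_(x in exhaust 1 n) f x)%R @[n --> \oo] -->
    (q + 1) * gig_const q a b - a * gig_const (q + 1) a b + b * gig_const (q - 1) a b.
  under eq_fun do rewrite fE'.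
  by apply: cvgD; first apply: cvgB; apply: cvgMr; exact: cvg_integral_exhaust_gig.
have c2 : (\int[mu]_(x in exhaust 1 n) f x)%R @[n --> \oo] --> 0.
  under eq_fun do rewrite fE.
  (* At both endpoints [|ln y| = ln (n + 1)], so the boundary terms are at most
     [expR K / (n + 1)]. *)
  have [K HK] := gig_exponent_le_ln (q + 1) a b a0 b0.
  have Fb n y : 0 < y -> `|ln y| = ln n.+1%:R -> `|F y| <= expR K * n.+1%:R^-1.
    move=> y0 ly; rewrite ger0_norm ?expR_ge0// -[n.+1%:R]lnK ?posrE// -expRN -expRD.
    by rewrite ler_expR -ly; exact: HK.
  have cK : expR K * n.+1%:R^-1 @[n --> \oo] --> 0.
    by rewrite -(mulr0 (expR K)); apply: cvgMr; exact: cvg_harmonic.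
  have z (u : nat -> R) : (forall n, `|F (u n)| <= expR K * n.+1%:R^-1) ->
      F (u n) @[n --> \oo] --> 0.
    move=> h; apply: norm_cvg0; apply: (@squeeze_cvgr _ _ _ _ (cst 0) _ _ _ 0 _ cK).
      by apply: nearW => n; rewrite normr_ge0 h.
    exact: cvg_cst.
  rewrite -(subr0 0); apply: cvgB; apply: z => n; apply: Fb.
  - by rewrite mul1r.
  - by rewrite mul1r ger0_norm// ln_ge0// ler1n.
  - by rewrite divr_gt0.
  - by rewrite mul1r lnV ?posrE// normrN ger0_norm// ln_ge0// ler1n.
have e : (q + 1) * gig_const q a b - a * gig_const (q + 1) a b + b * gig_const (q - 1) a b = 0.
  by apply: cvg_unique c1 c2; exact: norm_hausdorff.
lra.
Qed.

Lemma besselK_gig_const nu z : 0 < z ->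
  besselK nu z = 2^-1 * gig_const (- nu - 1) (z / 2) (z / 2).
Proof.
move=> z0; congr (_ * _); apply: eq_Rintegral => u; rewrite inE/= in_itv/= andbT => u0.
rewrite /powR gt_eqF// -expRD; congr expR; rewrite /gig_exponent; ring.
Qed.

(** The inversion constant [s / r] balances the two coefficients, both becoming [Num.sqrt (a * b)]
    as in the Bessel integral; the new power [- q - 2 = - (q + 1) - 1] gives the index [q + 1]. *)
Lemma gig_const_besselK q a b : 0 < a -> 0 < b ->
  gig_const q a b = 2 * expR (- (q + 1) * ln (Num.sqrt (a / b))) *
    besselK (q + 1) (2 * Num.sqrt (a * b)).
Proof.
move=> a0 b0; pose r := Num.sqrt a; pose s := Num.sqrt b.
have r0 : 0 < r by rewrite sqrtr_gt0.
have s0 : 0 < s by rewrite sqrtr_gt0.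
have aE : a = r * r by rewrite -expr2 sqr_sqrtr// ltW.
have bE : b = s * s by rewrite -expr2 sqr_sqrtr// ltW.
have abE : Num.sqrt (a * b) = r * s by rewrite sqrtrM// ltW.
have dE : Num.sqrt (a / b) = r / s by rewrite sqrtrM ?sqrtrV// ltW.
rewrite abE dE besselK_gig_const; last by rewrite !mulr_gt0.
rewrite /gig_const (gig_mass_inversion q a b (s / r)) ?divr_gt0//.
have -> : b / (s / r) = r * s by rewrite bE; field; rewrite !gt_eqF.
have -> : a * (s / r) = r * s by rewrite aE; field; rewrite !gt_eqF.
have -> : 2 * (r * s) / 2 = r * s by field.
have -> : - (q + 1) - 1 = - q - 2 by ring.
rewrite fineM//; last first.
  rewrite -gig_constE//; apply: gig_proper_gt0; exact: mulr_gt0.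
have -> : ln (r / s) = - ln (s / r) by rewrite -lnV ?posrE ?divr_gt0// invf_div.
by rewrite mulrNN /=; field.
Qed.

End gig_information.

(** * Closed formulas for the Rényi information and the entropy *)

Section gig_formulas.
Context {R : realType}.
Implicit Types (q a b c x : R).
Notation mu := (@lebesgue_measure R).
Notation D := (`]0%R, +oo[%classic : set R).

Implicit Types g t z nu alpha : R.

Definition gig_pdf q a b x : R := gig_kernel q a b x / gig_const q a b.

Definition gig_entropy_integral q a b : R :=
  (\int[mu]_(x in D) (gig_kernel q a b x * gig_exponent q a b x))%R.

Lemma gig_pdfE q a b x : gig_proper q a b ->
  gig_pdf q a b x = expR (gig_exponent q a b x - ln (gig_const q a b)).
Proof. by move=> ok; rewrite expRB lnK// posrE gig_const_gt0. Qed.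

(** The mass at [alpha (q, a, b)] stays extended-real: when [a] or [b] vanishes, properness need not
    pass to multiples of the parameters. *)
Lemma renyi_gig q a b alpha (f : R -> R) : gig_proper q a b ->
  (forall x, 0 < x -> f x = gig_pdf q a b x) ->
  renyi alpha f = (((1 - alpha)^-1)%:E * lne ((expR (- alpha * ln (gig_const q a b)))%:E *
    gig_mass (alpha * q) (alpha * a) (alpha * b)))%E.
Proof.
move=> ok fE; rewrite /renyi; congr (_ * lne _)%E.
rewrite /gig_mass -ge0_integralZl//; last 2 first.
- by apply/measurable_EFinP; exact: measurable_gig_kernel.
- by move=> x _; rewrite lee_fin ltW// gig_kernel_gt0.
apply: eq_integral => x; rewrite inE/= in_itv/= andbT => x0.
rewrite fE// gig_pdfE// /powR gt_eqF ?expR_gt0// expRK -EFinM -expRD; congr (expR _)%:E.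
by rewrite gig_exponentZ; ring.
Qed.

(** Here [ln f] is the exponent minus [ln Z]; both resulting integrands are integrable, so the
    extended-real integral splits. *)
Lemma shannon_gig q a b (f : R -> R) : gig_proper q a b ->
  (forall x, 0 < x -> f x = gig_pdf q a b x) ->
  shannon f = (ln (gig_const q a b) -
    gig_entropy_integral q a b / gig_const q a b)%:E.
Proof.
move=> ok fE; have Z0 := gig_const_gt0 _ _ _ ok.
have i1 := gig_entropy_integrable _ _ _ ok.
have i2 := gig_kernel_integrable _ _ _ ok.
rewrite /shannon; set I := integral _ _ _.
suff -> : I = (gig_entropy_integral q a b / gig_const q a b - ln (gig_const q a b))%:E.
  by rewrite -EFinN opprB.
pose Z := gig_const q a b.
have -> : I = (\int[mu]_(x in D)
    ((Z^-1)%:E * (gig_kernel q a b x * gig_exponent q a b x)%:E -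
     (ln Z / Z)%:E * (gig_kernel q a b x)%:E))%E.
  apply: eq_integral => x; rewrite inE/= in_itv/= andbT => x0.
  rewrite fE// {2}gig_pdfE// expRK -!EFinM -EFinB; congr EFin.
  by rewrite /gig_pdf -/Z; ring.
rewrite integralB//; last 2 first.
- exact: integrableZl.
- exact: integrableZl.
rewrite !integralZl//.
have e2 : (\int[mu]_(x in D) (gig_kernel q a b x)%:E)%E = Z%:E by rewrite /Z gig_constE.
have e1 : (\int[mu]_(x in D) (gig_kernel q a b x * gig_exponent q a b x)%:E)%E =
    (gig_entropy_integral q a b)%:E by rewrite fineK// integrable_fin_num.
rewrite e1 e2.
rewrite -!EFinM -EFinB; congr EFin.
by rewrite -/Z; field; rewrite gt_eqF.
Qed.

Lemma ln_sqrt_div a b : 0 < a -> 0 < b -> ln (Num.sqrt (a / b)) = ln (a / b) / 2.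
Proof.
by move=> a0 b0; rewrite -powR12_sqrt ?divr_ge0 ?ltW// ln_powR mulrC.
Qed.

Lemma besselK_gt0 nu a b : 0 < a -> 0 < b -> 0 < besselK nu (2 * Num.sqrt (a * b)).
Proof.
move=> a0 b0; rewrite besselK_gig_const ?mulr_gt0 ?sqrtr_gt0 ?mulr_gt0//.
by apply: gig_const_gt0; apply: gig_proper_gt0; rewrite mulrAC divff// mul1r sqrtr_gt0 mulr_gt0.
Qed.

Lemma ln_besselK nu a b : 0 < a -> 0 < b ->
  ln (besselK nu (2 * Num.sqrt (a * b))) =
  ln (gig_const (nu - 1) a b) + nu * ln (Num.sqrt (a / b)) - ln 2.
Proof.
move=> a0 b0; rewrite (gig_const_besselK (nu - 1))// subrK.
have := besselK_gt0 nu a b a0 b0; move: (besselK nu _) => K K0.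
rewrite !lnM ?posrE ?mulr_gt0 ?expR_gt0// expRK; ring.
Qed.

Lemma gig_density_pdf g t a b x : 0 < a -> 0 < b -> 0 < x ->
  gig_density g t a b x = gig_pdf (t - 2 * g) a b x.
Proof.
move=> a0 b0 x0; rewrite /gig_density /gig_pdf; set q := t - 2 * g.
rewrite (gig_const_besselK q)//.
have -> : (a / b) `^ ((q + 1) / 2) = expR ((q + 1) * ln (Num.sqrt (a / b))).
  rewrite /powR gt_eqF ?divr_gt0// ln_sqrt_div//; congr expR; ring.
have -> : x `^ q * expR (- a * x - b * x^-1) = gig_kernel q a b x.
  rewrite /powR gt_eqF// -expRD; congr expR; rewrite /gig_exponent; ring.
rewrite mulNr expRN; field.
by rewrite !gt_eqF ?besselK_gt0 ?expR_gt0.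
Qed.

(** Scaling [a] and [b] by [alpha] multiplies the Bessel argument by [alpha] and keeps [a / b]. The
    terms in [ln (Num.sqrt (a / b))] and [ln 2] then carry the total factor [1 - alpha] and, after
    division, cancel the first term of the formula. *)
Lemma gig_renyi_pdf g t alpha a b : 0 < alpha -> alpha != 1 -> 0 < a -> 0 < b ->
  (gig_renyi g t alpha a b)%:E = renyi alpha (gig_pdf (t - 2 * g) a b).
Proof.
move=> al0 al1 a0 b0; have ok := gig_proper_gt0 (t - 2 * g) a b a0 b0.
rewrite (renyi_gig _ _ _ _ _ ok (fun x _ => erefl)) /gig_renyi.
set q := t - 2 * g in ok *.
have aa0 : 0 < alpha * a by exact: mulr_gt0.
have ab0 : 0 < alpha * b by exact: mulr_gt0.
have ok' := gig_proper_gt0 (alpha * q) _ _ aa0 ab0.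
have Z0 := gig_const_gt0 _ _ _ ok; have Z0' := gig_const_gt0 _ _ _ ok'.
rewrite -(gig_constE _ _ _ ok') -EFinM lne_EFin ?mulr_gt0 ?expR_gt0// -EFinM; congr EFin.
have -> : 2 * alpha * Num.sqrt (a * b) = 2 * Num.sqrt ((alpha * a) * (alpha * b)).
  have -> : alpha * a * (alpha * b) = alpha ^+ 2 * (a * b) by ring.
  by rewrite (@sqrtrM _ (alpha ^+ 2) (a * b)) ?sqr_ge0// sqrtr_sqr gtr0_norm// mulrA.
rewrite ln_div ?posrE ?powR_gt0 ?besselK_gt0//.
rewrite ln_powR !ln_besselK// addrK.
have -> : alpha * a / (alpha * b) = a / b by field; rewrite !gt_eqF.
rewrite !lnM ?posrE ?expR_gt0 ?sqrtr_gt0 ?divr_gt0// expRK lnV ?posrE//.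
rewrite addrK; field; by rewrite subr_eq0 eq_sym.
Qed.

Lemma exp_family_index q a b x :
  expR (gig_exponent 0 a b x + q * ln x) = gig_kernel q a b x.
Proof. by congr expR; rewrite /gig_exponent; ring. Qed.

Lemma exp_family_index_integrable q a b : 0 < a -> 0 < b ->
  mu.-integrable D (fun x => (expR (gig_exponent 0 a b x + q * ln x))%:E).
Proof.
move=> a0 b0; rewrite (_ : (fun x => _) = EFin \o gig_kernel q a b).
  by apply: gig_kernel_integrable; exact: gig_proper_gt0.
by apply/funext => x; rewrite exp_family_index.
Qed.

Lemma measurable_ln_pos : measurable_fun D (@ln R).
Proof. by apply: continuous_measurable_pos => x; exact: continuous_ln. Qed.

(** The exponential family with [L = ln] and the index as parameter. The margin 1 is arbitrary, all
    indices being proper when [a, b > 0]. *)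
Lemma is_derive_gig_const q a b : 0 < a -> 0 < b ->
  is_derive q 1 (fun s => gig_const s a b)
    (\int[mu]_(x in D) (gig_kernel q a b x * ln x))%R.
Proof.
move=> a0 b0.
have E s x := exp_family_index s a b x.
have k s := exp_family_index_integrable s a b a0 b0.
have := @is_derive_exp_family R _ _ mu D (measurable_itv _) _ _ q 1
  (measurable_gig_exponent 0 a b) measurable_ln_pos ltr01 (k _) (k _).
have -> : (fun s => (\int[mu]_(x in D) expR (gig_exponent 0 a b x + s * ln x))%R) =
   (fun s => gig_const s a b).
  by apply/funext => s; apply: eq_Rintegral => x _; exact: E.
suff -> : (\int[mu]_(x in D) (expR (gig_exponent 0 a b x + q * ln x) * ln x))%R =
  (\int[mu]_(x in D) (gig_kernel q a b x * ln x))%R by [].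
by apply: eq_Rintegral => x _; rewrite E.
Qed.

Lemma gig_kernel_ln_integrable q a b : 0 < a -> 0 < b ->
  mu.-integrable D (fun x => (gig_kernel q a b x * ln x)%:E).
Proof.
move=> a0 b0.
have E s x := exp_family_index s a b x.
have k s := exp_family_index_integrable s a b a0 b0.
have -> : (fun x => (gig_kernel q a b x * ln x)%:E) =
    (fun x => (expR (gig_exponent 0 a b x + q * ln x) * ln x)%:E).
  by apply/funext => x; rewrite E.
exact: (@exp_family_integrableM R _ _ mu D (measurable_itv _) _ _ q 1
  (measurable_gig_exponent 0 a b) measurable_ln_pos ltr01 (k _) (k _)).
Qed.

(** The terms [a * x] and [b / x] of the exponent shift the index up and down by one, which produces
    the constants of the recurrence. *)
Lemma gig_entropy_integralE q a b : 0 < a -> 0 < b ->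
  gig_entropy_integral q a b =
  q * (\int[mu]_(x in D) (gig_kernel q a b x * ln x))%R
  - a * gig_const (q + 1) a b - b * gig_const (q - 1) a b.
Proof.
move=> a0 b0.
have il := gig_kernel_ln_integrable q a b a0 b0.
have ik k := gig_kernel_integrable k a b (gig_proper_gt0 k a b a0 b0).
have i1 : mu.-integrable D (EFin \o (fun x => q * (gig_kernel q a b x * ln x))).
  exact: (@integrableZl _ _ R mu D (measurable_itv _) q _ il).
have i2 k c : mu.-integrable D (EFin \o (fun x => c * gig_kernel k a b x)).
  exact: (@integrableZl _ _ R mu D (measurable_itv _) c _ (ik k)).
transitivity (\int[mu]_(x in D) (q * (gig_kernel q a b x * ln x)
    - a * gig_kernel (q + 1) a b x - b * gig_kernel (q - 1) a b x))%R.
  apply: eq_Rintegral => x; rewrite inE/= in_itv/= andbT => x0.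
  by rewrite gig_kernelDp// gig_kernelBp// /gig_exponent; ring.
rewrite RintegralB//; last first.
  exact: (@integrableB _ _ R mu D (measurable_itv _) _ _ i1 (i2 (q + 1) a)).
by rewrite RintegralB// !RintegralZl.
Qed.

Lemma besselKE nu a b : 0 < a -> 0 < b ->
  besselK nu (2 * Num.sqrt (a * b)) =
  2^-1 * (gig_const (nu - 1) a b * expR (nu * ln (Num.sqrt (a / b)))).
Proof.
move=> a0 b0; rewrite gig_const_besselK// subrK mulNr expRN.
by move: (besselK _ _) => K; field; rewrite gt_eqF ?expR_gt0.
Qed.

(** Product rule at fixed [a] and [b]: [nu] enters through the constant [gig_const (nu - 1) a b] and
    through the power of [Num.sqrt (a / b)]. *)
Lemma besselK_dotE nu a b : 0 < a -> 0 < b ->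
  let z := 2 * Num.sqrt (a * b) in
  besselK_dot nu z = besselK nu z *
   ((\int[mu]_(x in D) (gig_kernel (nu - 1) a b x * ln x))%R / gig_const (nu - 1) a b
     + ln (Num.sqrt (a / b))).
Proof.
move=> a0 b0 z; pose k := ln (Num.sqrt (a / b)).
have bE v : besselK v z = 2^-1 * (gig_const (v - 1) a b * expR (v * k)).
  exact: besselKE.
rewrite /besselK_dot (_ : (fun v => _) = (fun v => 2^-1 * (gig_const (v - 1) a b * expR (v * k)))); last first.
  by apply/funext => v; exact: bE.
have h1 : is_derive nu 1 (fun v : R => v - 1) (1 - 0).
  exact: (is_deriveB (is_derive_id nu (1 : R)) (is_derive_cst (1 : R) nu (1 : R))).
have h2 := @is_derive1_comp R (fun s => gig_const s a b) (fun v => v - 1) nu _ _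
   (is_derive_gig_const (nu - 1) a b a0 b0) h1.
have h3 : is_derive nu 1 (fun v : R => v * k) k.
  have := @is_deriveZ _ _ _ _ k _ _ _ (is_derive_id nu (1 : R)).
  rewrite /GRing.scale/= mulr1; congr (is_derive _ _ _ _).
  by apply/funext => v /=; rewrite /GRing.scale/= mulrC.
have h4 := @is_derive1_comp R expR (fun v => v * k) nu _ _ (is_derive_expR _) h3.
have h5 := @is_deriveZ _ _ _ _ 2^-1 _ _ _ (is_deriveM h2 h4).
have h6 : is_derive nu 1 (fun v => 2^-1 * (gig_const (v - 1) a b * expR (v * k))) _ := h5.
rewrite derive1E (@derive_val _ _ _ _ _ _ _ h6).
rewrite bE /GRing.scale/= subr0 mulr1 -/k; field.
by rewrite gt_eqF// gig_const_gt0//; exact: gig_proper_gt0.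
Qed.

(** The recurrence replaces [a Z(q + 1)] by [(q + 1) Z(q) + b Z(q - 1)]. This gives the summand
    [q + 1] and doubles [b Z(q - 1) / Z(q)], which becomes the last Bessel ratio; the multiples of
    [ln (Num.sqrt (a / b))] add up to 0. *)
Lemma gig_shannon_pdf g t a b : 0 < a -> 0 < b ->
  (gig_shannon g t a b)%:E = shannon (gig_pdf (t - 2 * g) a b).
Proof.
move=> a0 b0; have ok := gig_proper_gt0 (t - 2 * g) a b a0 b0.
rewrite (shannon_gig _ _ _ _ ok (fun x _ => erefl)); congr EFin.
rewrite /gig_shannon; set q := t - 2 * g in ok *.
have Z0 := gig_const_gt0 _ _ _ ok.
have rec := gig_const_recurrence q a b a0 b0.
rewrite besselK_dotE// ln_besselK// gig_entropy_integralE// rec addrK.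
set z := 2 * Num.sqrt (a * b).
have K0 : besselK (q + 1) z != 0 by rewrite gt_eqF// besselK_gt0.
(* The quotient of the two Bessel prefactors is [Num.sqrt (b / a)], which combines with [z] into
   [2 * b]. *)
have -> : z * (besselK q z / besselK (q + 1) z) = 2 * b * gig_const (q - 1) a b / gig_const q a b.
  have q2 : expR ((q + 1) * ln (Num.sqrt (a / b))) =
      expR (q * ln (Num.sqrt (a / b))) * Num.sqrt (a / b).
    by rewrite mulrDl mul1r expRD [X in _ * X]lnK// posrE sqrtr_gt0 divr_gt0.
  rewrite /z !besselKE// addrK q2; pose r := Num.sqrt a; pose s := Num.sqrt b.
  have r0 : 0 < r by rewrite sqrtr_gt0.
  have s0 : 0 < s by rewrite sqrtr_gt0.
  have -> : Num.sqrt (a * b) = r * s by rewrite sqrtrM// ltW.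
  have -> : Num.sqrt (a / b) = r / s by rewrite sqrtrM ?sqrtrV// ltW.
  move: (gig_const q a b) (gig_const (q - 1) a b) Z0 => Z Y Z0.
  have -> : b = s * s by rewrite -expr2 sqr_sqrtr// ltW.
  move: (expR _) (expR_gt0 (q * ln (r / s))) => E E0.
  by field; rewrite !gt_eqF.
rewrite lnM ?posrE ?sqrtr_gt0 ?divr_gt0// lnV ?posrE//.
field; by rewrite K0 gt_eqF.
Qed.

End gig_formulas.

(** * Limits at the boundary of the parameters and at order 1 *)

Section gig_limits.
Context {R : realType}.
Implicit Types (q a b c x : R).
Notation mu := (@lebesgue_measure R).
Notation D := (`]0%R, +oo[%classic : set R).

Implicit Types g t z nu alpha : R.

(** The limit [+oo] is included, since the integral of [f^alpha] may diverge at the limiting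
    parameters. *)
Lemma cvg_lne (T : Type) (F : set_system T) {FF : Filter F} (u : T -> \bar R) (l : \bar R) :
  (0 < l)%E -> u @ F --> l -> lne (u x) @[x --> F] --> lne l.
Proof.
case: l => [r|_ ul|//].
- rewrite lte_fin => r0 /fine_cvgP[ufin ur].
  rewrite lne_EFin//.
  have c : ln (fine (u x)) @[x --> F] --> ln r.
    exact: (cvg_comp _ _ ur (continuous_ln r0)).
  have c' : (ln (fine (u x)))%:E @[x --> F] --> (ln r)%:E.
    by apply: cvg_EFin; first exact: nearW.
  apply: cvg_trans c'.
  apply: near_eq_cvg; near=> x.
  have ux : u x \is a fin_num by near: x.
  have u0 : 0 < fine (u x) by near: x; exact: (cvgr_gt r ur).
  by rewrite /= -[in RHS](fineK ux) lne_EFin.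
- apply/cvgeyPge => A; near=> x.
  have ux : ((expR A)%:E <= u x)%E by near: x; exact: cvgey_ge.
  have e0 := expR_gt0 A.
  have u0 : (0 <= u x)%E by apply: le_trans ux; rewrite lee_fin ltW.
  have -> : A%:E = lne (expR A)%:E by rewrite lne_EFin// expRK.
  by rewrite lee_lne// in_itv/= leey andbT// lee_fin ltW.
Unshelve. all: by end_near. Qed.

Lemma gig_proper_le q a b a' b' : a <= a' -> b <= b' -> gig_proper q a b -> gig_proper q a' b'.
Proof.
move=> aa bb [a0 b0 aq bq]; split.
- exact: le_trans aa.
- exact: le_trans bb.
- by case: aq => [h|]; [left; exact: lt_le_trans aa|right].
- by case: bq => [h|]; [left; exact: lt_le_trans bb|right].
Qed.

Lemma gig_proper_shift q a b (i j e : R) : 0 <= i -> 0 <= j -> 0 <= e ->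
  gig_proper q a b -> gig_proper q (a + i * e) (b + j * e).
Proof. by move=> i0 j0 e0; apply: gig_proper_le; rewrite lerDl mulr_ge0. Qed.

Lemma gig_const_cvg q a b (i j : R) : gig_proper q a b -> 0 <= i -> 0 <= j ->
  gig_const q (a + i * e) (b + j * e) @[e --> 0^'+] --> gig_const q a b.
Proof.
move=> ok i0 j0; have := gig_mass_cvg q a b i j i0 j0.
by rewrite -gig_constE//; exact: fine_cvg.
Qed.

Lemma gig_pdf_cvg q a b (i j x : R) : gig_proper q a b -> 0 <= i -> 0 <= j ->
  gig_pdf q (a + i * e) (b + j * e) x @[e --> 0^'+] --> gig_pdf q a b x.
Proof.
move=> ok i0 j0.
have cvg_add (r k : R) : r + k * e @[e --> 0^'+] --> r.
  rewrite -[X in _ --> X]addr0 -[X in _ + X](mulr0 k); apply: cvgD; first exact: cvg_cst.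
  by apply: cvgMr; exact: cvg_at_right_filter.
have ck : gig_kernel q (a + i * e) (b + j * e) x @[e --> 0^'+] --> gig_kernel q a b x.
  exact: (@cvg_gig_kernel _ _ _ _ _ _ q _ _ x (cvg_add a i) (cvg_add b j)).
have cz := gig_const_cvg q a b i j ok i0 j0.
have z0 : gig_const q a b != 0 by rewrite gt_eqF// gig_const_gt0.
exact: (cvgM ck (cvgV z0 cz)).
Qed.

Lemma cvg_ln_gig_const q a b (i j : R) : gig_proper q a b -> 0 <= i -> 0 <= j ->
  ln (gig_const q (a + i * e) (b + j * e)) @[e --> 0^'+] --> ln (gig_const q a b).
Proof.
move=> ok i0 j0; have cz := gig_const_cvg q a b i j ok i0 j0.
exact: (cvg_comp _ _ cz (continuous_ln (gig_const_gt0 _ _ _ ok))).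
Qed.

Lemma renyi_gig_pdf_cvg q a b (i j alpha : R) : gig_proper q a b -> 0 <= i -> 0 <= j ->
  0 < alpha ->
  renyi alpha (gig_pdf q (a + i * e) (b + j * e)) @[e --> 0^'+] -->
  renyi alpha (gig_pdf q a b).
Proof.
move=> ok i0 j0 al0; rewrite (renyi_gig _ _ _ _ _ ok (fun x _ => erefl)).
have c1 : (expR (- alpha * ln (gig_const q (a + i * e) (b + j * e))))%:E @[e --> 0^'+] -->
    (expR (- alpha * ln (gig_const q a b)))%:E.
  apply: cvg_EFin; first exact: nearW.
  have h : - alpha * ln (gig_const q (a + i * e) (b + j * e)) @[e --> 0^'+] -->
      - alpha * ln (gig_const q a b) by apply: cvgMr; exact: cvg_ln_gig_const.
  exact: (cvg_comp _ _ h (@continuous_expR R _)).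
have c2 : gig_mass (alpha * q) (alpha * (a + i * e)) (alpha * (b + j * e)) @[e --> 0^'+] -->
    gig_mass (alpha * q) (alpha * a) (alpha * b).
  have := gig_mass_cvg (alpha * q) (alpha * a) (alpha * b) (alpha * i) (alpha * j)
    (mulr_ge0 (ltW al0) i0) (mulr_ge0 (ltW al0) j0).
  by under eq_fun do rewrite -!mulrA -!mulrDr.
have e0 := expR_gt0 (- alpha * ln (gig_const q a b)).
have m0 := gig_mass_gt0 (alpha * q) (alpha * a) (alpha * b).
have c3 : ((expR (- alpha * ln (gig_const q (a + i * e) (b + j * e))))%:E *
     gig_mass (alpha * q) (alpha * (a + i * e)) (alpha * (b + j * e)))%E @[e --> 0^'+] -->
    ((expR (- alpha * ln (gig_const q a b)))%:E * gig_mass (alpha * q) (alpha * a) (alpha * b))%E.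
  (* Both limits are positive, so the product is not of the form [0 * +oo]. *)
  by apply: cvgeM c1 c2; apply: neq0_mule_def; rewrite gt_eqF// mule_gt0.
have p0 : (0 < (expR (- alpha * ln (gig_const q a b)))%:E *
    gig_mass (alpha * q) (alpha * a) (alpha * b))%E by exact: mule_gt0.
have c5 : (((1 - alpha)^-1)%:E *
    lne ((expR (- alpha * ln (gig_const q (a + i * e) (b + j * e))))%:E *
     gig_mass (alpha * q) (alpha * (a + i * e)) (alpha * (b + j * e))))%E @[e --> 0^'+] -->
    (((1 - alpha)^-1)%:E * lne ((expR (- alpha * ln (gig_const q a b)))%:E *
      gig_mass (alpha * q) (alpha * a) (alpha * b)))%E.
  by apply: cvgeZl => //; exact: cvg_lne.
apply: cvg_trans c5; apply: near_eq_cvg; near=> e.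
have e1 : 0 <= e by apply: ltW; near: e; exact: nbhs_right_gt.
have ok' := gig_proper_shift q a b i j e i0 j0 e1 ok.
by rewrite (renyi_gig _ _ _ _ _ ok' (fun x _ => erefl)).
Unshelve. all: by end_near. Qed.

Lemma shannon_gig_pdf_cvg q a b (i j : R) : gig_proper q a b -> 0 <= i -> 0 <= j ->
  shannon (gig_pdf q (a + i * e) (b + j * e)) @[e --> 0^'+] -->
  shannon (gig_pdf q a b).
Proof.
move=> ok i0 j0; rewrite (shannon_gig _ _ _ _ ok (fun x _ => erefl)).
have cz := gig_const_cvg q a b i j ok i0 j0.
have z0 : gig_const q a b != 0 by rewrite gt_eqF// gig_const_gt0.
have c1 := cvg_ln_gig_const q a b i j ok i0 j0.
have c2 := gig_entropy_cvg q a b i j ok i0 j0.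
have c4 : (ln (gig_const q (a + i * e) (b + j * e)) -
    gig_entropy_integral q (a + i * e) (b + j * e) / gig_const q (a + i * e) (b + j * e))%:E
    @[e --> 0^'+] --> (ln (gig_const q a b) - gig_entropy_integral q a b / gig_const q a b)%:E.
  apply: cvg_EFin; first exact: nearW.
  exact: (cvgB c1 (cvgM c2 (cvgV z0 cz))).
apply: cvg_trans c4; apply: near_eq_cvg; near=> e.
have e1 : 0 <= e by apply: ltW; near: e; exact: nbhs_right_gt.
have ok' := gig_proper_shift q a b i j e i0 j0 e1 ok.
by rewrite (shannon_gig _ _ _ _ ok' (fun x _ => erefl)).
Unshelve. all: by end_near. Qed.

Lemma renyi_cvg_shannon q a b (f : R -> R) : gig_proper q a b ->
  (forall x, 0 < x -> f x = gig_pdf q a b x) ->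
  renyi alpha f @[alpha --> (1 : R)^'] --> shannon f.
Proof.
move=> ok fE; rewrite (shannon_gig _ _ _ _ ok fE).
have [del /andP[d0 d1] H] := gig_proper_near _ _ _ ok.
pose phi s := gig_const (s * q) (s * a) (s * b).
have Z0 := gig_const_gt0 _ _ _ ok.
have phi1 : phi 1 = gig_const q a b by rewrite /phi !mul1r.
have dphi : is_derive (1 : R) 1 phi (gig_entropy_integral q a b).
  have k (s : R) : `|s - 1| <= del ->
      mu.-integrable D (fun x => (expR (cst 0 x + s * gig_exponent q a b x))%:E).
    move=> /H ok'; rewrite (_ : (fun x => _) = EFin \o gig_kernel (s * q) (s * a) (s * b)).
      exact: gig_kernel_integrable.
    by apply/funext => x; rewrite /= exp_family_gig_exponent.
  have k1 : `|1 + del - 1| <= del by rewrite addrAC subrr add0r gtr0_norm.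
  have k2 : `|1 - del - 1| <= del by rewrite addrAC subrr add0r normrN gtr0_norm.
  have := @is_derive_exp_family R _ _ mu D (measurable_itv _) (cst 0) _ 1 del
    (measurable_cst _) (measurable_gig_exponent q a b) d0 (k _ k1) (k _ k2).
  have -> : (fun s => (\int[mu]_(x in D) expR (cst 0 x + s * gig_exponent q a b x))%R) = phi.
    apply/funext => s; apply: eq_Rintegral => x _; exact: exp_family_gig_exponent.
  suff -> : (\int[mu]_(x in D) (expR (cst 0 x + 1 * gig_exponent q a b x) * gig_exponent q a b x))%R =
    gig_entropy_integral q a b by [].
  by apply: eq_Rintegral => x _; rewrite exp_family_gig_exponent !mul1r.
(* For [s] near 1 this is the logarithm of the integral of [f^s]: it vanishes at 1, and the Rényi
   information is minus its difference quotient there. *)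
pose psi s := ln (phi s) - s * ln (phi 1).
have psi1 : psi 1 = 0 by rewrite /psi mul1r subrr.
have phi10 : 0 < phi 1 by rewrite phi1.
have dpsi : is_derive (1 : R) 1 psi (gig_entropy_integral q a b / phi 1 - ln (phi 1)).
  have h1 := @is_derive1_comp R (@ln R) phi 1 _ _ (is_derive1_ln phi10) dphi.
  have h2 : is_derive (1 : R) 1 (fun s : R => s * ln (phi 1)) (ln (phi 1)).
    have := @is_deriveZ _ _ _ _ (ln (phi 1)) _ _ _ (is_derive_id (1 : R) (1 : R)).
    rewrite /GRing.scale/= mulr1; congr (is_derive _ _ _ _).
    by apply/funext => v /=; rewrite /GRing.scale/= mulrC.
  apply: (is_derive_eq (is_deriveB h1 h2 : is_derive (1 : R) 1 psi _)).
  by rewrite mulrC.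
have lim : (1 - alpha)^-1 * psi alpha @[alpha --> (1 : R)^'] -->
    ln (gig_const q a b) - gig_entropy_integral q a b / gig_const q a b.
  (* Sequences carry the limit at [alpha = 1] to the limit at [h = alpha - 1 = 0] that defines the
     derivative. *)
  apply/cvgr_dnbhsP => u [u1 cu].
  have dv := @derive_val _ _ _ _ _ _ _ dpsi.
  have : derivable psi 1 1 by have [] := dpsi.
  move=> /cvg_ex[l hl]; have le : l = gig_entropy_integral q a b / phi 1 - ln (phi 1).
    by rewrite -dv; apply/esym/cvg_lim.
  move/cvgr_dnbhsP : hl => /(_ (fun n => u n - 1)) hl.
  have {hl} : (fun n => (u n - 1)^-1 *: (psi ((u n - 1) *: 1 + 1) - psi 1)) @ \oo --> l.
    apply: hl; split; first by move=> n; rewrite subr_eq0.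
    exact/subr_cvg0.
  have el : - l = ln (gig_const q a b) - gig_entropy_integral q a b / gig_const q a b.
    by rewrite le opprB phi1.
  move=> /cvgN; rewrite el.
  set v := (X in X @ _ --> _ -> _); suff -> : (fun n => (1 - u n)^-1 * psi (u n)) = v by [].
  apply/funext => n; rewrite /v.
  rewrite fctE psi1 subr0 /GRing.scale/= mulr1 subrK.
  by rewrite -mulNr -invrN opprB.
have c4 : ((1 - alpha)^-1 * psi alpha)%:E @[alpha --> (1 : R)^'] -->
    (ln (gig_const q a b) - gig_entropy_integral q a b / gig_const q a b)%:E.
  by apply: cvg_EFin; first exact: nearW.
apply: cvg_trans c4; apply: near_eq_cvg; near=> alpha.
have al : `|alpha - 1| <= del.
  rewrite distrC; near: alpha; exists del => //= y /= yd _; exact: ltW.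
have ok' := H _ al; have Z0' := gig_const_gt0 _ _ _ ok'.
rewrite (renyi_gig _ _ _ _ _ ok fE) -gig_constE// -EFinM lne_EFin ?mulr_gt0 ?expR_gt0//.
rewrite -EFinM /psi /phi !mul1r lnM ?posrE ?expR_gt0// expRK; congr (_ * _)%:E.
by rewrite mulNr addrC.
Unshelve. all: by end_near. Qed.

End gig_limits.

(** * Scale and speed of the diffusion *)

Section gig_diffusion_laws.
Context {R : realType}.
Implicit Types (q a b c x : R).
Notation mu := (@lebesgue_measure R).
Notation D := (`]0%R, +oo[%classic : set R).

Variables gamma lambda beta1 beta2 beta3 x0 : R.
Hypotheses (lambda0 : 0 < lambda) (x00 : 0 < x0).

Let theta1 := 2 * beta1 / lambda ^+ 2.
Let theta2 := 2 * beta2 / lambda ^+ 2.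
Let theta3 := 2 * beta3 / lambda ^+ 2.
Let b := gig_drift gamma beta1 beta2 beta3.
Let s := gig_diffusion gamma lambda.
Let Phi := gig_exponent theta1 theta2 theta3.

(** The powers of [y] involving [gamma] cancel, leaving the derivative of [Phi], of index [theta1].
    Only the factor [s x ^+ 2] of the speed density keeps [gamma] and shifts the index to
    [theta1 - 2 * gamma]. *)
Lemma gig_drift_ratio (y : R) : 0 < y ->
  2 * b y / s y ^+ 2 = theta1 / y - theta2 + theta3 / y ^+ 2.
Proof.
move=> y0; have yn : y != 0 by rewrite gt_eqF.
rewrite /b /s /gig_drift /gig_diffusion.
pose P := y `^ gamma; have P0 : 0 < P by rewrite powR_gt0.
have E : y `^ (2 * gamma) = P ^+ 2 by rewrite mulrC powRrM powR_mulrn// ltW.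
have E1 : y `^ (2 * gamma - 1) = P ^+ 2 / y.
  by rewrite powRB ?yn ?implybT// E powRr1// ltW.
have E2 : y `^ (2 * (gamma - 1)) = P ^+ 2 / y ^+ 2.
  have -> : 2 * (gamma - 1) = 2 * gamma - 2 by ring.
  by rewrite powRB ?yn ?implybT// E powR_mulrn// ltW.
rewrite E1 E2 E -/P /theta1 /theta2 /theta3; field.
by rewrite yn !gt_eqF.
Qed.

Lemma integral_drift_ratio (u v : R) : 0 < u -> u <= v ->
  (\int[mu]_(y in `[u, v]) (2 * b y / s y ^+ 2))%R = Phi v - Phi u.
Proof.
move=> u0 uv.
have dF (x : R) : 0 < x -> is_derive x 1 Phi (theta1 / x - theta2 + theta3 / x ^+ 2).
  exact: is_derive_gig_exponent.
have cf (x : R) : 0 < x ->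
    {for x, continuous (fun y : R => theta1 / y - theta2 + theta3 / y ^+ 2)}.
  move=> xp; have xn : x != 0 by rewrite gt_eqF.
  apply: cvgD; first apply: cvgB; last first.
  - apply: cvgMr; apply: cvgV; first by rewrite expf_neq0.
    by apply: cvgM; exact: cvg_id.
  - exact: cvg_cst.
  - by apply: cvgMr; apply: cvgV => //; exact: cvg_id.
have := continuous_FTC2_pos _ _ u v u0 uv dF cf.
rewrite /Rintegral => h; rewrite (_ : integral _ _ _ = (Phi v - Phi u)%:E)//.
rewrite -h; apply: eq_integral => y; rewrite inE/= in_itv/= => /andP[uy _].
by rewrite gig_drift_ratio// (lt_le_trans u0).
Qed.

Lemma gig_scale_densityE (x : R) : 0 < x ->
  scale_density b s x0 x = expR (Phi x0) * expR (- Phi x).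
Proof.
move=> xp; rewrite /scale_density /oriented_integral -expRD; congr expR.
case: (leP x0 x) => [xx|/ltW xx]; rewrite integral_drift_ratio//; ring.
Qed.

Lemma gig_speed_densityE (x : R) : 0 < x ->
  speed_density b s x0 x =
  (lambda ^- 2 * expR (- Phi x0)) * gig_kernel (theta1 - 2 * gamma) theta2 theta3 x.
Proof.
move=> xp; rewrite /speed_density gig_scale_densityE// /s /gig_diffusion.
have E : x `^ gamma ^+ 2 = expR (gamma * 2 * ln x).
  by rewrite /powR gt_eqF// -expRM_natr; congr expR; ring.
rewrite exprMn E.
have -> : gig_kernel (theta1 - 2 * gamma) theta2 theta3 x =
    expR (Phi x) * (expR (gamma * 2 * ln x))^-1.
  rewrite -expRN -expRD; congr expR; rewrite /Phi /gig_exponent; ring.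
rewrite !expRN; field.
by rewrite !gt_eqF ?expR_gt0.
Qed.

Let c := lambda ^- 2 * expR (- Phi x0).
Let c0 : 0 < c. Proof. by rewrite mulr_gt0 ?expR_gt0// invr_gt0 exprn_gt0. Qed.
Let q := theta1 - 2 * gamma.

Lemma integral_gig_speed :
  (\int[mu]_(x in D) (speed_density b s x0 x)%:E = c%:E * gig_mass q theta2 theta3)%E.
Proof.
rewrite /gig_mass -ge0_integralZl//; last 3 first.
- by apply/measurable_EFinP; exact: measurable_gig_kernel.
- by move=> x _; rewrite lee_fin ltW// gig_kernel_gt0.
- by rewrite lee_fin ltW.
apply: eq_integral => x; rewrite inE/= in_itv/= andbT => xp.
by rewrite gig_speed_densityE// EFinM.
Qed.

Lemma ergodic_gig_mass_lty : ergodic b s x0 -> (gig_mass q theta2 theta3 < +oo)%E.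
Proof.
move=> [_ _]; rewrite integral_gig_speed.
have := gig_mass_ge0 q theta2 theta3; case: (gig_mass _ _ _) => //= [r|].
  by move=> *; rewrite ltry.
by rewrite gt0_muley ?lte_fin.
Qed.

(** The constant [c], which carries the base point, cancels in the normalization. *)
Lemma invariant_density_gig (x : R) : gig_proper q theta2 theta3 -> 0 < x ->
  invariant_density b s x0 x = gig_pdf q theta2 theta3 x.
Proof.
move=> ok xp; rewrite /invariant_density gig_speed_densityE//.
rewrite /Rintegral integral_gig_speed -gig_constE// -EFinM /= /gig_pdf -/c -/q.
by have Z0 := gig_const_gt0 _ _ _ ok; field; rewrite !gt_eqF.
Qed.

(** Since [Phi x <= K - |ln x|], the scale density is at least a multiple of [x^-1], whose integral
    diverges at both ends. *)
Lemma gig_ergodic : 0 < theta2 -> 0 < theta3 -> ergodic b s x0.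
Proof.
move=> t2 t3; have [K HK] := gig_exponent_le_ln theta1 _ _ t2 t3.
pose f x := expR (Phi x0) * expR (- Phi x).
have mf : measurable_fun D f.
  apply: measurable_funM => //; apply: measurableT_comp => //.
  by apply: measurableT_comp => //; exact: measurable_gig_exponent.
pose d := expR (Phi x0) * expR (- K).
have d0 : 0 < d by rewrite mulr_gt0 ?expR_gt0.
have fd x : 0 < x -> d * x^-1 <= f x.
  move=> xp; rewrite /d /f -mulrA ler_pM2l ?expR_gt0// -[X in X^-1]lnK ?posrE//.
  rewrite -expRN -expRD ler_expR.
  have := HK _ xp; have := ler_norm (- ln x); rewrite normrN -/Phi; lra.
split.
- rewrite -(integral_ge_inv0 f d x0 d0 x00 mf); last by move=> x xp _; exact: fd.
  apply: eq_integral => x; rewrite inE/= in_itv/= => /andP[xp _].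
  by rewrite gig_scale_densityE.
- rewrite -(integral_ge_invy f d x0 d0 x00 mf); last first.
    by move=> x xx; apply: fd; exact: lt_le_trans xx.
  apply: eq_integral => x; rewrite inE/= in_itv/= andbT => xx.
  by rewrite gig_scale_densityE// (lt_le_trans x00).
- rewrite integral_gig_speed -gig_constE -?EFinM ?ltry//.
  exact: gig_proper_gt0.
Qed.

End gig_diffusion_laws.

(** On the boundary the parameter conditions do not imply ergodicity: for [theta3 = 0] and
    [theta1 - 2 * gamma <= -1] the speed measure is infinite. Hence ergodicity is derived for
    positive [theta2], [theta3] and assumed otherwise. *)
Theorem theorem4p1 (R : realType) (gamma lambda beta1 beta2 beta3 x0 : R) :
  0 <= gamma -> 0 < lambda -> 0 < x0 ->
  let theta1 := 2 * beta1 / lambda ^+ 2 in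
  let theta2 := 2 * beta2 / lambda ^+ 2 in
  let theta3 := 2 * beta3 / lambda ^+ 2 in
  [\/ [/\ 1 <= theta1, 0 < theta2 & 0 <= theta3],
      [/\ 1 - 2 * gamma <= theta1, theta1 < 1, 0 < theta2 & 0 < theta3] |
      [/\ theta1 < 1 - 2 * gamma, 0 <= theta2 & 0 < theta3]] ->
  let b := gig_drift gamma beta1 beta2 beta3 in
  let s := gig_diffusion gamma lambda in
  let f := invariant_density b s x0 in
  (0 < theta2 -> 0 < theta3 -> ergodic b s x0) /\
  (ergodic b s x0 ->
   [/\ forall x : R, 0 < x ->
         has_value (fun t2 t3 => gig_density gamma theta1 t2 t3 x)
           theta2 theta3 (f x),
       forall alpha : R, 0 < alpha -> alpha != 1 ->
         has_value (fun t2 t3 => (gig_renyi gamma theta1 alpha t2 t3)%:E)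
           theta2 theta3 (renyi alpha f),
       has_value (fun t2 t3 => (gig_shannon gamma theta1 t2 t3)%:E)
         theta2 theta3 (shannon f) &
       renyi a f @[a --> (1 : R)^'] --> shannon f]).
Proof.
move=> _ lambda0 x00 t1 t2 t3 cases b s f; split; first exact: gig_ergodic.
move=> erg; pose q := t1 - 2 * gamma.
have [t20 t30 t23] : [/\ 0 <= t2, 0 <= t3 & 0 < t2 \/ 0 < t3].
  case: cases => [[_ h1 h2]|[_ _ h1 h2]|[_ h1 h2]]; split => //; try exact: ltW;
    by [left|right].
have ok : gig_proper q t2 t3.
  by apply: gig_mass_lty_proper => //; exact: ergodic_gig_mass_lty erg.
have fE x : 0 < x -> f x = gig_pdf q t2 t3 x by move=> xp; exact: invariant_density_gig.
have at_right0 (T : topologicalType) (F G : R -> T) (l : T) :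
    (forall e, 0 < e -> F e = G e) -> G e @[e --> 0^'+] --> l -> F e @[e --> 0^'+] --> l.
  move=> FG; apply: cvg_trans; apply: near_eq_cvg; near=> e; apply/esym/FG.
  by near: e; exact: nbhs_right_gt.
(* One argument for the density at a point, the Rényi information and the entropy: [G] is the
   functional of the density, and the direction [(i, j)] points along the vanishing parameter. *)
have limits (T : topologicalType) (F : R -> R -> T) (G : (R -> R) -> T) :
    (forall u v, 0 < u -> 0 < v -> F u v = G (gig_pdf q u v)) ->
    (forall i j, 0 <= i -> 0 <= j ->
      G (gig_pdf q (t2 + i * e) (t3 + j * e)) @[e --> 0^'+] --> G (gig_pdf q t2 t3)) ->
    has_value F t2 t3 (G (gig_pdf q t2 t3)).
  move=> FG cG; split.
  - by move=> h2 h3; rewrite FG.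
  - move=> t3E; have t2p : 0 < t2 by case: t23 => //; rewrite t3E ltxx.
    apply: at_right0 (cG 0 1 (lexx _) ler01) => e e0.
    by rewrite mul0r addr0 mul1r t3E add0r; exact: FG.
  - move=> t2E; have t3p : 0 < t3 by case: t23 => //; rewrite t2E ltxx.
    apply: at_right0 (cG 1 0 ler01 (lexx _)) => e e0.
    by rewrite mul0r addr0 mul1r t2E add0r; exact: FG.
(* The two functions agree only on positive reals, so the equality passes through their common
   closed form. *)
have renyiE al : renyi al f = renyi al (gig_pdf q t2 t3).
  by rewrite !(renyi_gig q t2 t3).
have shannonE : shannon f = shannon (gig_pdf q t2 t3).
  by rewrite !(shannon_gig q t2 t3).
split.
- move=> x xp; rewrite (fE x xp).
  apply: (limits _ _ (fun h => h x)) => [u v u0 v0|i j i0 j0].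
    exact: gig_density_pdf.
  exact: gig_pdf_cvg.
- move=> al al0 al1; rewrite renyiE.
  apply: (limits _ _ (renyi al)) => [u v u0 v0|i j i0 j0].
    exact: gig_renyi_pdf.
  exact: renyi_gig_pdf_cvg.
- rewrite shannonE.
  apply: (limits _ _ (@shannon R)) => [u v u0 v0|i j i0 j0].
    exact: gig_shannon_pdf.
  exact: shannon_gig_pdf_cvg.
- exact: renyi_cvg_shannon ok fE.
Unshelve. all: by end_near. Qed.
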